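(* Let $H:[0,\infty)\times\mathbb{T}^d\times\mathcal{P}(\mathbb{T}^d)\times\mathbb{R}^d\to\mathbb{R}$ be continuous and assume there exists $C>0$ such that for all $p\in\mathbb{R}^d$, $s,t\ge 0$, $\mu,\nu\in\mathcal{P}(\mathbb{T}^d)$, $x,y\in\mathbb{T}^d$, $$|H(t,x,\mu,p)-H(s,y,\nu,p)|\le C(1+|p|)\big(|t-s|+W_2(\mu,\nu)+|x-y|\big).$$ Let $U$ and $V$ be respectively a viscosity sub-solution and a viscosity super-solution of $$\partial_tU(t,\mu)+\int_{\mathbb{T}^d}H(t,x,\mu,D_\mu U(t,\mu,x))\,\mu(dx)=0\quad\text{in }(0,\infty)\times\mathcal{P}(\mathbb{T}^d)$$ such that $U(0,\mu)\le V(0,\mu)$ for all $\mu\in\mathcal{P}(\mathbb{T}^d)$. Then $U(t,\mu)\le V(t,\mu)$ for all $t\ge0$ and $\mu\in\mathcal{P}(\mathbb{T}^d)$.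
   Context: $\mathbb{T}^d=\mathbb{R}^d/\mathbb{Z}^d$; $\mathcal{P}(\mathbb{T}^d)$ is the set of Borel probability measures on $\mathbb{T}^d$ with the weak topology. For $x,y\in\mathbb{T}^d$, $|x-y|$ is the torus distance and $y-x\in\mathbb{R}^d$ denotes a (fixed, measurably chosen) representative of minimal norm. $\Pi(\mu,\mu')$ is the set of couplings of $\mu$ and $\mu'$, and $W_2(\mu,\mu')^2=\inf_{\gamma\in\Pi(\mu,\mu')}\int|x-y|^2\gamma(dx,dy)$. Super-differential. For $U:[0,\infty)\times\mathcal{P}(\mathbb{T}^d)\to\mathbb{R}$ upper semi-continuous (usc), $(\theta,\psi)\in\partial^+U(t,\mu)$ means: $\theta\in\mathbb{R}$; $\psi:\mathbb{T}^d\to\mathcal{P}(\mathbb{R}^d)$ is measurable and there is $R>0$ such that for all $x$ the support of $\psi(x,\cdot)$ is contained in the ball $B(0,R)$; and for all $s\le t$, $\mu'\in\mathcal{P}(\mathbb{T}^d)$, $\gamma\in\Pi(\mu,\mu')$, $$U(s,\mu')\le U(t,\mu)+\theta(s-t)+\int_{\mathbb{T}^{2d}}\int_{\mathbb{R}^d}z\cdot(y-x)\,\psi(x,dz)\gamma(dx,dy)+o\Big(|s-t|+\Big(\int|x-y|^2d\gamma\Big)^{1/2}\Big),$$ where $o(\cdot)$ is uniform in $(s,\mu',\gamma)$. For $U$ lower semi-continuous (lsc), $\partial^-U(t,\mu)=\{(-\theta,\,x\mapsto(-\mathrm{Id})_\#\psi(x,\cdot)):(\theta,\psi)\in\partial^+(-U)(t,\mu)\}$.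 Set $\bar{\mathcal H}(t,\mu,\psi)=\int_{\mathbb{T}^d\times\mathbb{R}^d}H(t,x,\mu,z)\,\psi(x,dz)\mu(dx)$. A usc (resp. lsc) function $U:[0,\infty)\times\mathcal{P}(\mathbb{T}^d)\to\mathbb{R}$ is a viscosity sub-solution (resp. super-solution) if for all $t>0$, $\mu\in\mathcal{P}(\mathbb{T}^d)$ and $(\theta,\psi)\in\partial^+U(t,\mu)$ (resp. $\partial^-U(t,\mu)$): $\theta+\bar{\mathcal H}(t,\mu,\psi)\le0$ (resp. $\ge0$). *)

(* Defs.v *)
From HB Require Import structures.
From mathcomp Require Import all_boot all_order all_algebra.
From mathcomp Require Import all_classical all_reals all_analysis.

Set Implicit Arguments.
Unset Strict Implicit.
Unset Printing Implicit Defensive.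

Import Order.TTheory GRing.Theory Num.Theory.
Import numFieldNormedType.Exports.

Local Open Scope classical_set_scope.
Local Open Scope ring_scope.
Local Open Scope quotient_scope.

(* Matrices carry the Borel sigma-algebra of their product topology. *)
HB.instance Definition _ (R : realType) (m n : nat) :=
  Measurable.copy 'M[R]_(m, n) (g_sigma_algebraType (@open 'M[R]_(m, n))).

(* The library norm on 'rV[R]_d is the sup norm; |.| is the Euclidean norm. *)
Definition dotv (R : realType) (d : nat) (u v : 'rV[R]_d) : R :=
  \sum_(i < d) u 0 i * v 0 i.

Definition enorm (R : realType) (d : nat) (v : 'rV[R]_d) : R :=
  Num.sqrt (dotv v v).

Section Torus.
Variables (R : realType) (d : nat).

Definition integer_lattice (v : 'rV[R]_d) : bool := v \is a mxOver Num.int.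

Lemma integer_lattice_closed : zmod_closed integer_lattice.
Proof.
split=> [|u v /mxOverP uZ /mxOverP vZ]; first by apply: mxOver0; rewrite rpred0.
by apply/mxOverP => i j; rewrite !mxE rpredB.
Qed.

HB.instance Definition _ :=
  GRing.isZmodClosed.Build 'rV[R]_d integer_lattice integer_lattice_closed.

Definition torus : Type :=
  {ideal_quot GRing.ZmodClosed.clone _ integer_lattice _}.

HB.instance Definition _ := ZmodQuotient.on torus.

(* Same open sets as the library's [quotient_topology], whose choice structure
   however conflicts with that of the quotient group. *)
Definition torus_open (A : set torus) : Prop := open (\pi_torus @^-1` A).

Lemma torus_openT : torus_open [set: torus].
Proof. exact: openT. Qed.

Lemma torus_openI : setI_closed torus_open.
Proof. by move=> A B; exact: openI. Qed.

Lemma torus_open_bigcup (I : Type) (F : I -> set torus) :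
  (forall i, torus_open (F i)) -> torus_open (\bigcup_i F i).
Proof. by move=> oF; apply: bigcup_open => i _; exact: oF. Qed.

HB.instance Definition _ := isOpenTopological.Build torus
  torus_openT torus_openI torus_open_bigcup.
HB.instance Definition _ := isPointed.Build torus 0.
HB.instance Definition _ :=
  Measurable.copy torus (g_sigma_algebraType (@open torus)).

Definition torus_norm (x : torus) : R :=
  inf [set enorm v | v in [set v : 'rV[R]_d | \pi_torus v = x]].

Definition torus_dist (x y : torus) : R := torus_norm (x - y).

(* [r (x, y)] is the chosen representative of y - x. *)
Definition minimal_representative (r : torus * torus -> 'rV[R]_d) : Prop :=
  measurable_fun [set: torus * torus] r /\
  forall x y : torus,
    \pi_torus (r (x, y)) = y - x /\ enorm (r (x, y)) = torus_norm (y - x).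

End Torus.

Section ProbTorus.
Variables (R : realType) (d : nat).
Local Notation T := (torus R d).

Definition prob : Type := probability T R.

HB.instance Definition _ := Choice.on prob.

(* No boundedness is required of the test functions: the torus is compact. *)
Definition integrate_continuous (mu : prob) :
    {ptws {f : T -> R | continuous f} -> R} :=
  fun f => \int[mu]_x (sval f) x.

HB.instance Definition _ :=
  Topological.copy prob (initial_topology integrate_continuous).

(* A library measure is a function on all sets, with junk values off the
   sigma-algebra, so the marginals are compared on measurable sets only. *)
Definition couplings (mu nu : prob) : set (probability (T * T)%type R) :=
  [set gamma | forall A : set T, measurable A ->
     gamma (fst @^-1` A) = mu A /\ gamma (snd @^-1` A) = nu A].

Definition transport_cost (gamma : probability (T * T)%type R) : R :=
  \int[gamma]_q (torus_dist q.1 q.2 ^+ 2).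

Definition W2 (mu nu : prob) : R :=
  Num.sqrt (inf [set transport_cost gamma | gamma in couplings mu nu]).

End ProbTorus.

Section Semicontinuity.
Variables (R : realType) (X : topologicalType) (D : set X) (f : X -> R).

Definition lsc : Prop := lower_semicontinuous (fun x : subspace D => (f x)%:E).

Definition usc : Prop :=
  lower_semicontinuous (fun x : subspace D => (- f x)%:E).

End Semicontinuity.

Section Viscosity.
Variables (R : realType) (d : nat).
Local Notation T := (torus R d).
Local Notation P := (prob R d).
Local Notation E := 'rV[R]_d.

Definition msupport (m : probability E R) : set E :=
  [set z | forall A : set E, open A -> A z -> (0 < m A)%E].

Lemma measurable_oppv : measurable_fun [set: E] (-%R : E -> E).
Proof.
apply: (@measurability _ _ E E setT -%R (@open E)) => //.
move=> _ [A oA <-]; apply: sub_sigma_algebra; rewrite setTI.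
by move: A oA; apply/continuousP => x; exact: opp_continuous.
Qed.

HB.instance Definition _ :=
  isMeasurableFun.Build _ _ E E (-%R : E -> E) measurable_oppv.

Definition reflected_law (m : probability E R) : probability E R :=
  distribution m (-%R : {mfun E >-> E}).

(* Functions of time are total on R; only their values at t >= 0 matter. *)
Definition time_space : set (R * P) := [set q | 0 <= q.1].

Variable r : T * T -> E.

(* [pprobability] carries the sigma-algebra generated by the evaluations
   m |-> m A, i.e. the Borel sigma-algebra of the weak topology. *)
Definition superdiff (U : R -> P -> R) (t : R) (mu : P) :
    set (R * (T -> probability E R)) :=
  [set q | let: (theta, psi) := q in
    [/\ measurable_fun [set: T] (psi : T -> pprobability E R),
        exists2 rho : R, 0 < rho &
          forall x, msupport (psi x) `<=` [set z | enorm z < rho] &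
        exists2 o : R -> R, o =o_ (nbhs (0 : R)) (fun h : R => h) &
          forall (s : R) (mu' : P) (gamma : probability (T * T)%type R),
            0 <= s <= t -> couplings mu mu' gamma ->
            U s mu' <= U t mu + theta * (s - t)
              + \int[gamma]_xy \int[psi xy.1]_z dotv z (r xy)
              + o (`|s - t| + Num.sqrt (transport_cost gamma))]].

Definition subdiff (U : R -> P -> R) (t : R) (mu : P) :
    set (R * (T -> probability E R)) :=
  [set (- q.1, fun x => reflected_law (q.2 x)) | q in
     superdiff (fun s nu => - U s nu) t mu].

Variable H : R -> T -> P -> E -> R.

Definition Hbar (t : R) (mu : P) (psi : T -> probability E R) : R :=
  \int[mu]_x \int[psi x]_z H t x mu z.

Definition viscosity_subsolution (U : R -> P -> R) : Prop :=
  usc time_space (fun q => U q.1 q.2) /\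
  forall (t : R) (mu : P) theta psi, 0 < t ->
    superdiff U t mu (theta, psi) -> theta + Hbar t mu psi <= 0.

Definition viscosity_supersolution (V : R -> P -> R) : Prop :=
  lsc time_space (fun q => V q.1 q.2) /\
  forall (t : R) (mu : P) theta psi, 0 < t ->
    subdiff V t mu (theta, psi) -> 0 <= theta + Hbar t mu psi.

End Viscosity.

(* Main.v *)
Require Import Defs.
From HB Require Import structures.
From mathcomp Require Import all_boot all_order all_algebra.
From mathcomp Require Import all_classical all_reals all_analysis.
From mathcomp Require Import measurable_realfun ring lra.

(** Variables are doubled, but the maximisation runs over couplings instead of
    pairs of measures.  Suppose [U t1 mu1 > V t1 mu1] and, for small [lam > 0],
    let [(t, s, g)] maximise
      [U t mu - V s nu - lam t - (|x - y|^2-cost of g + (t - s)^2) / (2 eps)],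
    where [mu] and [nu] are the marginals of the coupling [g]; the maximiser is
    then automatically an optimal coupling and no existence theory for [W2] is
    needed.  Disintegrating [g] along its first marginal as the law of
    [(x, F x u)] with [u] uniform on [0, 1], any plan from [mu] to [mu'] can be
    glued to [g]; since [|x' - y|^2 <= |b|^2 + 2 b . (x' - x) + |x' - x|^2] for
    every minimal representative [b] of [x - y], maximality says that the law
    of [b / eps] given [x] is a superdifferential of [U] at [(t, mu)].  The same
    [b], read from the [y] side, gives a subdifferential of [V] at [(s, nu)],
    so that the two viscosity inequalities involve the same momentum [b / eps].
    Their difference is at most [C (1 + |x - y| / eps) (|t - s| + W2 + |x - y|)]
    integrated against [g], which vanishes with the penalty as [eps -> 0],
    whereas it must be at least [lam].

    Compactness of the space of couplings and the disintegration are both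
    obtained by coding the torus by binary sequences: a consistent family of
    masses of cylinders is the law, under Lebesgue measure, of the address of a
    point in nested subdivisions of [0, 1]; the masses are ultrafilter limits
    for compactness and Radon-Nikodym densities for the disintegration. *)

Set Implicit Arguments.
Unset Strict Implicit.
Unset Printing Implicit Defensive.

Import Order.TTheory GRing.Theory Num.Theory.
Import numFieldNormedType.Exports.
Local Open Scope classical_set_scope.
Local Open Scope ring_scope.
Local Open Scope quotient_scope.

(** * Laws and integrals of bounded measurable functions *)

Section Law.
Context d d' (X : measurableType d) (Y : measurableType d') (R : realType).

Definition law (P : probability X R) (f : X -> Y)
    (mf : measurable_fun [set: X] f) : probability Y R :=
  distribution P (mfun_Sub (mem_set mf)).

Lemma lawE (P : probability X R) (f : X -> Y) (mf : measurable_fun [set: X] f)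
    (A : set Y) : law P mf A = P (f @^-1` A).
Proof. by []. Qed.

End Law.

Lemma measurable_fun_gt d (X : measurableType d) (R : realType) (f : X -> R) :
  (forall y, measurable [set x | y < f x]) -> measurable_fun [set: X] f.
Proof.
move=> mf; apply: (measurability _ (RGenOInfty.measurableE R)) => _ [_ [y ->] <-].
rewrite setTI (_ : _ @^-1` _ = [set x | y < f x])//.
by apply/seteqP; split=> x /=; rewrite in_itv /= andbT.
Qed.

(** A class integrable against every probability at once, so that integrands can be moved freely
    between measures. *)
Definition bounded_measurable d (X : measurableType d) (R : realType)
    (f : X -> R) : Prop :=
  measurable_fun [set: X] f /\ exists M : R, forall x, `|f x| <= M.

Section BoundedMeasurable.
Context d (X : measurableType d) (R : realType).
Local Notation bm := (@bounded_measurable d X R).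
Implicit Types (f g : X -> R) (P : probability X R).

Lemma bm_integrable P f : bm f -> P.-integrable setT (EFin \o f).
Proof.
move=> [mf [M fM]]; apply: measurable_bounded_integrable => //.
  by rewrite ltey_eq fin_num_measure.
exists M; split; first exact: num_real.
by move=> N MN x _; apply: le_trans (fM x) (ltW MN).
Qed.

Lemma bm_cst (c : R) : bm (fun=> c).
Proof. by split; [exact: measurable_cst | exists `|c|]. Qed.

Lemma bmD f g : bm f -> bm g -> bm (fun x => f x + g x).
Proof.
move=> [mf [M fM]] [mg [N gN]]; split; first exact: measurable_funD.
by exists (M + N) => x; apply: le_trans (ler_normD _ _) (lerD (fM x) (gN x)).
Qed.

Lemma bmM f g : bm f -> bm g -> bm (fun x => f x * g x).
Proof.
move=> [mf [M fM]] [mg [N gN]]; split; first exact: measurable_funM.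
by exists (M * N) => x; rewrite normrM ler_pM.
Qed.

Lemma bmZ c f : bm f -> bm (fun x => c * f x).
Proof. by move=> bf; apply: bmM => //; exact: bm_cst. Qed.

Lemma bmN f : bm f -> bm (fun x => - f x).
Proof.
move=> [mf [M fM]]; split; last by exists M => x; rewrite normrN.
exact: measurableT_comp.
Qed.

Lemma bmB f g : bm f -> bm g -> bm (fun x => f x - g x).
Proof. by move=> bf bg; apply: bmD => //; exact: bmN. Qed.

Lemma bm_sum (I : Type) (s : seq I) (f : I -> X -> R) :
  (forall i, bm (f i)) -> bm (fun x => \sum_(i <- s) f i x).
Proof.
move=> bf; elim: s => [|i s IH].
  by under [X in bm X]eq_fun do rewrite big_nil; exact: bm_cst.
by under [X in bm X]eq_fun do rewrite big_cons; exact: bmD.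
Qed.

Lemma bm_indic (A : set X) : measurable A -> bm (\1_A).
Proof.
move=> mA; split; first exact: measurable_indic.
by exists 1 => x; rewrite indicE; case: (_ \in _); rewrite ?normr1 ?normr0.
Qed.

Lemma meanD P f g : bm f -> bm g ->
  \int[P]_x (f x + g x) = \int[P]_x f x + \int[P]_x g x.
Proof. by move=> bf bg; rewrite RintegralD//; exact: bm_integrable. Qed.

Lemma meanB P f g : bm f -> bm g ->
  \int[P]_x (f x - g x) = \int[P]_x f x - \int[P]_x g x.
Proof. by move=> bf bg; rewrite RintegralB//; exact: bm_integrable. Qed.

Lemma meanZ P c f : bm f -> \int[P]_x (c * f x) = c * \int[P]_x f x.
Proof. by move=> bf; rewrite RintegralZl//; exact: bm_integrable. Qed.

Lemma mean_cst P c : \int[P]_x c = c.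
Proof. by rewrite Rintegral_cst//= probability_setT mulr1. Qed.

Lemma mean_le P f g : bm f -> bm g -> (forall x, f x <= g x) ->
  \int[P]_x f x <= \int[P]_x g x.
Proof. by move=> bf bg fg; apply: le_Rintegral => //; exact: bm_integrable. Qed.

Lemma mean_sum P (I : Type) (s : seq I) (f : I -> X -> R) :
  (forall i, bm (f i)) ->
  \int[P]_x (\sum_(i <- s) f i x) = \sum_(i <- s) \int[P]_x f i x.
Proof.
move=> bf; elim: s => [|i s IH].
  under eq_Rintegral do rewrite big_nil.
  by rewrite big_nil mean_cst.
under eq_Rintegral do rewrite big_cons.
by rewrite meanD// ?big_cons ?IH//; exact: bm_sum.
Qed.

Lemma mean_indic P (A : set X) : measurable A -> \int[P]_x \1_A x = fine (P A).
Proof. by move=> mA; rewrite /Rintegral integral_indic// setIT. Qed.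

Lemma fine_probK P (A : set X) : measurable A -> (fine (P A))%:E = P A.
Proof. by move=> mA; rewrite fineK// fin_num_measure. Qed.

Lemma fine_prob01 P (A : set X) : measurable A -> 0 <= fine (P A) <= 1.
Proof.
by move=> mA; rewrite -!lee_fin fine_probK// measure_ge0 probability_le1.
Qed.

Lemma fine_probT P : fine (P [set: X]) = 1.
Proof. by rewrite probability_setT. Qed.

Lemma fine_probU P (A B : set X) : measurable A -> measurable B ->
  A `&` B = set0 -> fine (P (A `|` B)) = fine (P A) + fine (P B).
Proof.
by move=> mA mB AB; rewrite measureU// fineD// fin_num_measure.
Qed.

End BoundedMeasurable.

Section Transfer.
Context d d' (X : measurableType d) (Y : measurableType d') (R : realType).

Lemma bm_comp (f : X -> Y) (h : Y -> R) : measurable_fun [set: X] f ->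
  bounded_measurable h -> bounded_measurable (fun x => h (f x)).
Proof.
move=> mf [mh [M hM]]; split; first exact: (measurableT_comp mh mf).
by exists M.
Qed.

Lemma mean_law_comp (P : probability X R) (f : X -> Y)
    (mf : measurable_fun [set: X] f) (h : Y -> R) :
  measurable_fun [set: Y] h -> bounded_measurable (fun x => h (f x)) ->
  \int[law P mf]_y h y = \int[P]_x h (f x).
Proof.
move=> mh bh; rewrite /Rintegral /law /distribution integral_pushforward//.
- exact/measurable_EFinP.
- by rewrite preimage_setT; exact: (bm_integrable P bh).
Qed.

Lemma mean_law (P : probability X R) (f : X -> Y)
    (mf : measurable_fun [set: X] f) (h : Y -> R) : bounded_measurable h ->
  \int[law P mf]_y h y = \int[P]_x h (f x).
Proof.
by move=> bh; rewrite mean_law_comp//; [case: bh|exact: bm_comp mf bh].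
Qed.

Lemma eq_mean (P Q : probability X R) (h : X -> R) :
  (forall A, measurable A -> P A = Q A) -> \int[P]_x h x = \int[Q]_x h x.
Proof.
by move=> PQ; congr fine; apply: eq_measure_integral => A mA _; exact: PQ.
Qed.

(** The inner integral is the finite part of [fubini_F], hence measurable, and averaging keeps the
    bound of [f]. *)
Lemma bm_fubini (P : probability X R) (Q : probability Y R) (f : X * Y -> R) :
  bounded_measurable f ->
  bounded_measurable (fun x => \int[Q]_y f (x, y)) /\
  \int[(P \x Q)%E]_z f z = \int[P]_x \int[Q]_y f (x, y).
Proof.
move=> bf; have [mf [M fM]] := bf.
have bfx x : bounded_measurable (fun y => f (x, y)).
  split; last by exists M.
  by apply: (measurableT_comp mf); exact: measurable_pair1.
have if_ : (P \x Q)%E.-integrable setT (EFin \o f).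
  exact: bm_integrable bf.
have fE x : (\int[Q]_y f (x, y))%:E = fubini_F Q (EFin \o f) x.
  rewrite /Rintegral fineK//; apply: integrable_fin_num => //.
  exact: (bm_integrable Q (bfx x)).
split.
  split; last first.
    exists M => x; rewrite ler_norml; apply/andP; split.
      rewrite -(mean_cst Q (- M)); apply: mean_le => //; first exact: bm_cst.
      by move=> y; have := fM (x, y); rewrite ler_norml => /andP[].
    rewrite -[leRHS](mean_cst Q M); apply: mean_le => //; first exact: bm_cst.
    by move=> y; have := fM (x, y); rewrite ler_norml => /andP[].
  apply/measurable_EFinP; rewrite (_ : _ \o _ = fubini_F Q (EFin \o f)); last first.
    by apply/funext => x; rewrite /= fE.
  exact: (measurable_fubini_F if_).
rewrite /Rintegral -(integral12_prod_meas1 if_); congr fine.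
by apply: eq_integral => x _; rewrite -fE.
Qed.

Lemma prob_eq_mean (P : probability X R) (Q : probability Y R) (A : set X) (B : set Y) :
  measurable A -> measurable B ->
  \int[P]_x (\1_A x : R) = \int[Q]_y (\1_B y : R) -> P A = Q B.
Proof.
move=> mA mB; rewrite !mean_indic// => PQ.
by rewrite -(fine_probK P mA) PQ fine_probK.
Qed.

End Transfer.

(** * Binary sequences *)

Section BitSequences.

Definition bits : Type := nat -> bool.

HB.instance Definition _ := Choice.on bits.
HB.instance Definition _ := isPointed.Build bits (fun=> false).

(* Words are stored with the most recent letter first. *)
Fixpoint initial_word (b : bits) (n : nat) : seq bool :=
  if n is m.+1 then b m :: initial_word b m else [::].

Definition cylinder (w : seq bool) : set bits :=
  [set b | initial_word b (size w) = w].

Definition cantor : measurableType (range cylinder).-sigma :=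
  g_sigma_algebraType (range cylinder).

Lemma size_initial b n : size (initial_word b n) = n.
Proof. by elim: n => //= n ->. Qed.

Lemma initial_cylinder b n : cylinder (initial_word b n) b.
Proof. by rewrite /cylinder /= size_initial. Qed.

Lemma initial_le b b' m n : (m <= n)%N -> initial_word b n = initial_word b' n ->
  initial_word b m = initial_word b' m.
Proof.
move=> /subnK <-; elim: (n - m)%N => [//|k IH] /=.
by move=> [_]; exact: IH.
Qed.

Lemma initial_nth b b' n : initial_word b n = initial_word b' n <->
  forall k, (k < n)%N -> b k = b' k.
Proof.
elim: n => [//|n IH] /=; split=> [[bn /IH bb'] k|bb'].
  by rewrite ltnS leq_eqVlt => /predU1P[->|/bb'].
by rewrite bb'//; congr cons; apply/IH => k kn; apply: bb'; rewrite ltnS ltnW.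
Qed.

Lemma measurable_cylinder w : measurable (cylinder w : set cantor).
Proof. by apply: sub_sigma_algebra; exists w. Qed.

(** The shorter word either begins the longer one or is incompatible with it. This yields a
    pi-system for the uniqueness of measures. *)
Lemma cylinderI v w : cylinder v `&` cylinder w = set0 \/
  cylinder v `&` cylinder w = cylinder v \/
  cylinder v `&` cylinder w = cylinder w.
Proof.
wlog vw : v w / (size v <= size w)%N.
  move=> H; have [/H //|/ltnW /H] := leqP (size v) (size w).
  by rewrite setIC => -[|[|]]; tauto.
have [[b [vb wb]]|/set0P/negP/negPn/eqP] := pselect (cylinder v `&` cylinder w !=set0);
  last by left.
right; right; apply/seteqP; split=> [b' [//]|b' wb']; split=> //.
by rewrite /cylinder /= -[RHS]vb; apply: initial_le vw _; rewrite wb wb'.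
Qed.

Lemma word_bigcup_measurable d (X : measurableType d) (D : set (seq bool))
    (F : seq bool -> set X) : (forall w, D w -> measurable (F w)) ->
  measurable (\bigcup_(w in D) F w).
Proof.
move=> mF; rewrite bigcup_mkcond; apply: countable_bigcupT_measurable => //.
by move=> w; case: ifP => //; rewrite inE => /mF.
Qed.

(** Such a set is the union of the cylinders it contains, and there are only countably many
    words. *)
Lemma measurable_cantor_open (A : set cantor) :
  (forall b, A b -> exists n, forall b', initial_word b' n = initial_word b n -> A b') ->
  measurable A.
Proof.
move=> oA; rewrite (_ : A = \bigcup_(w in [set w | cylinder w `<=` A]) cylinder w).
  by apply: word_bigcup_measurable => w _; exact: measurable_cylinder.
apply/seteqP; split=> [b Ab|b [w wA /wA //]].
have [n An] := oA b Ab; exists (initial_word b n); last exact: initial_cylinder.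
by move=> b'; rewrite /cylinder /= size_initial => /An.
Qed.

Lemma measurable_bit n : measurable_fun [set: cantor] (fun b : cantor => b n).
Proof.
apply: (measurable_fun_bool true); rewrite setTI.
apply: measurable_cantor_open => b /= bn; exists n.+1 => b' /=.
by move=> [-> _].
Qed.

Lemma measurable_fun_cantor d (X : measurableType d) (f : X -> cantor) :
  (forall n, measurable_fun [set: X] (fun x => f x n)) ->
  measurable_fun [set: X] f.
Proof.
move=> mf; apply: (@measurability _ _ X cantor setT f (range cylinder)) => //.
move=> _ [_ [w _ <-] <-]; rewrite setTI.
elim: w => [|a w IH]; first by rewrite (_ : _ @^-1` _ = setT)//; apply/seteqP.
rewrite (_ : _ @^-1` _ = (fun x => f x (size w)) @^-1` [set a] `&`
    f @^-1` (cylinder w)).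
  by apply: measurableI => //; rewrite -[X in measurable X]setTI; exact: mf.
by apply/seteqP; split=> x; rewrite /cylinder /= => -[-> ->].
Qed.

End BitSequences.

(** * Lebesgue measure on the unit interval and addresses of points *)

Section UniformMeasure.
Variable R : realType.

Definition unit_lebesgue : set (measurableTypeR R) -> \bar R :=
  mrestr lebesgue_measure (measurable_itv `[0 : R, 1[).

HB.instance Definition _ := Measure.on unit_lebesgue.

Lemma unit_lebesgueE (a b : R) (A : set R) : 0 <= a -> a <= b -> b <= 1 ->
  (forall u, 0 <= u < 1 -> A u <-> a <= u < b) -> unit_lebesgue A = (b - a)%:E.
Proof.
move=> a0 ab b1 Aab; rewrite /unit_lebesgue /mrestr.
rewrite (_ : _ `&` _ = `[a, b[%classic).
  by rewrite lebesgue_measure_itv /= lte_fin; case: ltgtP ab => // -> _; rewrite subrr.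
apply/seteqP; split=> u; rewrite /= in_itv /=.
  by move=> [Au]; rewrite in_itv /= => u01; exact/Aab.
move=> /andP[au ub]; rewrite in_itv /=.
have u01 : 0 <= u < 1 by rewrite (le_trans a0)//= (lt_le_trans ub).
by split=> //; apply/Aab => //; rewrite au.
Qed.

Lemma unit_lebesgue_setT : unit_lebesgue setT = 1%E.
Proof. by rewrite (@unit_lebesgueE 0 1)// ?subr0. Qed.

HB.instance Definition _ :=
  Measure_isProbability.Build _ _ _ unit_lebesgue unit_lebesgue_setT.

End UniformMeasure.
Arguments unit_lebesgue : clear implicits.

(* The unit interval is cut recursively into half-open intervals of prescribed
   lengths [p w], and [branch] records the address of a point: under Lebesgue
   measure its law gives mass [p w] to the cylinder of [w]. *)
Section Branch.
Context {R : realType}.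
Implicit Types (p : seq bool -> R) (u : R) (w : seq bool).

Fixpoint left_end p w : R :=
  if w is b :: v then left_end p v + (if b then p (false :: v) else 0) else 0.

Fixpoint branch_word p u n : seq bool :=
  if n is m.+1 then
    (left_end p (branch_word p u m) + p (false :: branch_word p u m) <= u)
      :: branch_word p u m
  else [::].

Definition branch p u : cantor :=
  fun n => head false (branch_word p u n.+1).

(** Kolmogorov's conditions on the masses of cylinders. *)
Definition consistent p : Prop :=
  [/\ forall w, 0 <= p w, p [::] = 1 &
      forall w, p w = p (false :: w) + p (true :: w)].

Lemma initial_branch p u n : initial_word (branch p u) n = branch_word p u n.
Proof. by elim: n => //= n ->. Qed.

(** Induction on the word: one more letter tells on which side of the cut
    [left_end p w + p (false :: w)] the point [u] lies. *)
Lemma branch_wordP p u w : consistent p -> 0 <= u < 1 ->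
  (branch_word p u (size w) = w) <-> (left_end p w <= u < left_end p w + p w).
Proof.
move=> [p0 p1 pD] u01; elim: w => [|b w IH] /=; first by rewrite p1 add0r; split.
have := p0 (true :: w); have := p0 (false :: w); have := pD w.
split=> [[bE wE]|].
  move: bE; rewrite wE; move/IH: wE => /andP[lu ul].
  by case: b => [bu|/negbT]; rewrite -?ltNge => *; apply/andP; split; lra.
move=> bu; have wu : branch_word p u (size w) = w.
  by apply/IH; case: b bu => /andP[? ?]; apply/andP; split; lra.
rewrite wu; congr cons; case: b bu => /andP[? ?]; first by lra.
by apply/negbTE; rewrite -ltNge; lra.
Qed.

Lemma left_end_bounds p w : consistent p ->
  0 <= left_end p w /\ left_end p w + p w <= 1.
Proof.
move=> [p0 p1 pD]; elim: w => [|b w [l0 l1]] /=; first by rewrite p1 add0r.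
by have := p0 (true :: w); have := p0 (false :: w); have := pD w;
  case: b => *; split; lra.
Qed.

Lemma branch_law p w : consistent p ->
  unit_lebesgue R [set u | initial_word (branch p u) (size w) = w] = (p w)%:E.
Proof.
move=> cp; have [l0 l1] := left_end_bounds w cp; have [p0 _ _] := cp.
rewrite (@unit_lebesgueE _ (left_end p w) (left_end p w + p w))//.
- by congr EFin; ring.
- by rewrite lerDl.
- by move=> u u01 /=; rewrite initial_branch; exact: branch_wordP.
Qed.

(** An initial word of the address is decided by finitely many comparisons of measurable functions.
    The masses may vary with [z] because the disintegration uses conditional masses. *)
Lemma measurable_branch d (Z : measurableType d) (p : seq bool -> Z -> R)
    (u : Z -> R) :
  (forall w, measurable_fun [set: Z] (p w)) -> measurable_fun [set: Z] u ->
  measurable_fun [set: Z] (fun z => branch (p ^~ z) (u z)).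
Proof.
move=> mp mu.
have ml w : measurable_fun [set: Z] (fun z => left_end (p ^~ z) w).
  elim: w => [|b w IH] /=; first exact: measurable_cst.
  by apply: measurable_funD => //; case: b.
have mw n w : measurable [set z | branch_word (p ^~ z) (u z) n = w].
  elim: n w => [|n IH] [|b w].
  - by rewrite (_ : mkset _ = setT)//; apply/seteqP; split=> z.
  - by rewrite (_ : mkset _ = set0)//; apply/seteqP; split=> z.
  - by rewrite (_ : mkset _ = set0)//; apply/seteqP; split=> z.
  rewrite (_ : mkset _ = (fun z => left_end (p ^~ z) w + p (false :: w) z <= u z)
      @^-1` [set b] `&` [set z | branch_word (p ^~ z) (u z) n = w]).
    apply: measurableI => //; rewrite -[X in measurable X]setTI.
    by apply: measurable_fun_ler => //; apply: measurable_funD.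
  by apply/seteqP; split=> [z /= [<- <-]|z /= [<- <-]].
apply: measurable_fun_cantor => n; apply: (measurable_fun_bool true).
rewrite setTI (_ : _ @^-1` _ = \bigcup_(w in [set w | head false w])
    [set z | branch_word (p ^~ z) (u z) n.+1 = w]).
  by apply: word_bigcup_measurable.
apply/seteqP; split=> z; rewrite /branch /bigcup /preimage /mkset.
  by move: n.+1 => m; exists (branch_word (p ^~ z) (u z) m).
by move: n.+1 => m [w + ->].
Qed.

End Branch.

(** * Measures on products with binary sequences: uniqueness and disintegration *)

Section ProductWithCantor.
Context d (X : measurableType d) (R : realType).

(** The empty set is included because disjoint cylinders intersect in it. *)
Let rectangles : set (set (X * cantor)) :=
  [set S | S = set0 \/
    exists A, measurable A /\ exists w, S = A `*` cylinder w].

(** Rectangles over cylinders are stable under intersection and generate the product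
    sigma-algebra. *)
Lemma cantor_prod_unique (P Q : probability (X * cantor)%type R) :
  (forall A w, measurable A -> P (A `*` cylinder w) = Q (A `*` cylinder w)) ->
  forall S, measurable S -> P S = Q S.
Proof.
move=> PQ S mS.
have cyl0 : cylinder [::] = setT by apply/seteqP; split.
have rect A w : measurable A -> rectangles (A `*` cylinder w).
  by move=> mA; right; exists A; split=> //; exists w.
apply: (g_sigma_algebra_measure_unique rectangles _ (fun=> setT)) => //.
- move=> _ [->|[A [mA [w ->]]]]; first exact: measurable0.
  by apply: measurableX => //; exact: measurable_cylinder.
- by move=> _; rewrite -setXTT -cyl0; exact: rect.
- by apply/seteqP; split=> // x _; exists 0%N.
- move=> S1 S2 [->|[A [mA [v ->]]]]; first by rewrite set0I; left.
  move=> [->|[B [mB [w ->]]]]; first by rewrite setI0; left.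
  rewrite -setXI; have mAB := measurableI _ _ mA mB.
  by case: (cylinderI v w) => [->|[->|->]];
    [rewrite setX0; left|exact: rect|exact: rect].
- move=> _ [->|[A [mA [w ->]]]]; first by rewrite !measure0.
  exact: PQ.
- by move=> _; rewrite ltey_eq fin_num_measure.
(* Both projections are measurable for the sigma-algebra generated by the rectangles, which
   therefore contains the product sigma-algebra. *)
pose GT := g_sigma_algebraType rectangles.
have mfst : measurable_fun [set: GT] (fst : GT -> X).
  move=> _ A mA; rewrite setTI; apply: sub_sigma_algebra.
  rewrite (_ : _ @^-1` _ = A `*` cylinder [::]); first exact: rect.
  by rewrite cyl0; apply/seteqP; split=> [x|x []].
have msnd : measurable_fun [set: GT] (snd : GT -> cantor).
  apply: (@measurability _ _ GT cantor setT snd (range cylinder)) => //.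
  move=> _ [_ [w _ <-] <-]; rewrite setTI; apply: sub_sigma_algebra.
  rewrite (_ : _ @^-1` _ = setT `*` cylinder w); first exact: rect.
  by apply/seteqP; split=> [x|x []].
move: mS; rewrite measurable_prod_measurableType.
apply: smallest_sub => [|_ [A mA [B mB <-]]]; first exact: smallest_sigma_algebra.
rewrite (_ : _ `*` _ = (setT `&` fst @^-1` A) `&` (setT `&` snd @^-1` B)).
  by apply: (@measurableI _ GT); [exact: mfst|exact: msnd].
by rewrite !setTI; apply/seteqP; split.
Qed.

Section Slice.
Variables (g : probability (X * cantor)%type R) (w : seq bool).

Let slice (A : set X) : \bar R := g (A `*` cylinder w).

Let slice0 : slice set0 = 0%E.
Proof. by rewrite /slice set0X. Qed.

Let slice_ge0 A : (0 <= slice A)%E.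
Proof. exact: measure_ge0. Qed.

Let slice_sigma_additive : semi_sigma_additive slice.
Proof.
move=> F mF tF mUF; rewrite /slice (_ : _ `*` _ = \bigcup_n (F n `*` cylinder w)).
  apply: measure_semi_sigma_additive.
  - by move=> n; apply: measurableX => //; exact: measurable_cylinder.
  - move=> i j _ _ [[x b] [[/= Fi _] [/= Fj _]]]; apply: tF => //.
    by exists x.
  - apply: bigcup_measurable => n _; apply: measurableX => //.
    exact: measurable_cylinder.
by apply/seteqP; split=> [[x b] [[n _ Fx] wb]|[x b] [n _ [Fx wb]]];
  [exists n|split=> //; exists n].
Qed.

HB.instance Definition _ := isMeasure.Build _ _ _ slice
  slice0 slice_ge0 slice_sigma_additive.

Let slice_fin : fin_num_fun slice.
Proof.
move=> A mA; rewrite /slice fin_num_measure//.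
by apply: measurableX => //; exact: measurable_cylinder.
Qed.

HB.instance Definition _ := Measure_isFinite.Build _ _ _ slice slice_fin.

(** The slice over a cylinder lies below the first marginal, so Radon-Nikodym applies; [p x] is the
    conditional mass of the cylinder given [x]. *)
Lemma slice_density :
  exists p : X -> R, [/\ measurable_fun [set: X] p, forall x, 0 <= p x,
    (law g measurable_fst).-integrable setT (EFin \o p) &
    forall A, measurable A ->
      g (A `*` cylinder w) = (\int[law g measurable_fst]_(x in A) (p x)%:E)%E].
Proof.
have dom : slice `<< law g measurable_fst.
  apply/null_content_dominatesP => A mA A0; apply/eqP.
  rewrite eq_le measure_ge0 andbT -A0; apply: le_measure; rewrite ?inE.
  - by apply: measurableX => //; exact: measurable_cylinder.
  - by rewrite -[X in measurable X]setTI; exact: measurable_fst.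
  - by move=> [x b] [].
have := radon_nikodym_sigma_finite dom => -[f [f0 ffin fint fE]].
have fineE x : (fine (f x))%:E = f x by rewrite fineK.
exists (fine \o f); split.
- apply/measurable_EFinP; rewrite (_ : _ \o _ = f); last exact/funext.
  exact: measurable_int fint.
- by move=> x; rewrite fine_ge0.
- by rewrite (_ : _ \o _ = f); last exact/funext.
- move=> A mA; rewrite -[LHS]/(slice A) fE//.
  by apply: eq_integral => x _; rewrite /= fineE.
Qed.

End Slice.

(** [F (x, u)] is the address of [u] in the subdivision whose lengths are the conditional masses at
    [x]. By [branch_law] each cylinder receives its conditional mass; integrating in [x] recovers
    [g] on rectangles, which determine it. *)
Lemma cantor_disintegration (g : probability (X * cantor)%type R) :
  exists F : X * measurableTypeR R -> cantor, measurable_fun [set: _] F /\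
    forall S, measurable S ->
      g S = (law g measurable_fst \x unit_lebesgue R)%E
              [set z | S (z.1, F z)].
Proof.
have /choice[p pP] := slice_density g.
set mu := law g measurable_fst in pP *.
have mp w : measurable_fun [set: X] (p w) by case: (pP w).
(* Additivity of the densities in [w] holds outside a null set only; [branch]
   makes sense for arbitrary masses, so the exceptional points need no care. *)
have consistent_ae : {ae mu, forall x, consistent (p ^~ x)}.
  have p1 : {ae mu, forall x, p [::] x = 1}.
    have : ae_eq mu setT (EFin \o p [::]) (cst 1%E).
      have [_ _ ip pE] := pP [::].
      apply: integral_ae_eq => // A _ mA; rewrite -pE// integral_cst// mul1e.
      rewrite [RHS]lawE; congr (g _).
      by apply/seteqP; split=> [x []|x].
    by apply: filterS => x /(_ I) [].
  have pD w : {ae mu, forall x, p w x = p (false :: w) x + p (true :: w) x}.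
    have [mw _ iw wE] := pP w.
    have [m0 p0 i0 E0] := pP (false :: w).
    have [m1 p1' i1 E1] := pP (true :: w).
    have : ae_eq mu setT (EFin \o p w)
        (fun x => (p (false :: w) x)%:E + (p (true :: w) x)%:E)%E.
      apply: integral_ae_eq => //.
        by apply: emeasurable_funD; exact/measurable_EFinP.
      move=> A _ mA; rewrite ge0_integralD//; last first.
      - exact/measurable_funTS/measurable_EFinP.
      - by move=> x _; rewrite lee_fin.
      - exact/measurable_funTS/measurable_EFinP.
      - by move=> x _; rewrite lee_fin.
      rewrite -[LHS]wE// -E0// -E1//.
      rewrite (_ : A `*` cylinder w = (A `*` cylinder (false :: w)) `|`
                                      (A `*` cylinder (true :: w))).
        rewrite measureU//.
        - by apply: measurableX => //; exact: measurable_cylinder.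
        - by apply: measurableX => //; exact: measurable_cylinder.
        - apply/seteqP; split=> // -[x b] [[_ +] [_]]; rewrite /cylinder /=.
          by move=> [->].
      apply/seteqP; split=> -[x b].
        move=> [/= Ax bw].
        have : cylinder (b (size w) :: w) b by rewrite /cylinder /= [X in _ :: X]bw.
        by case: (b (size w)) => ?; [right|left]; split.
      by move=> [] [/= Ax]; rewrite /cylinder /= => -[_ bw]; split.
    by apply: filterS => x /(_ I) /=; rewrite -EFinD => -[].
  (* Additivity must hold for all words off a single null set: words are enumerated by their codes,
     with a trivial condition at integers that code no word. *)
  pose D n x := if (unpickle n : option (seq bool)) is Some w
      then p w x = p (false :: w) x + p (true :: w) x else True.
  have : {ae mu, forall x, forall n, D n x}.
    apply: ae_foralln => n; rewrite /D; case: unpickle => [w|]; first exact: pD.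
    exact: aeW.
  move: p1; apply: filterS2 => x px1 pxD; split=> //.
  - by move=> w; case: (pP w).
  - by move=> w; have := pxD (pickle w); rewrite /D pickleK.
pose F (z : X * measurableTypeR R) := branch (fun w => p w z.1) (z.2 : R).
have mF : measurable_fun setT F.
  apply: measurable_branch; last exact: measurable_snd.
  by move=> w; apply: (measurableT_comp (mp w)); exact: measurable_fst.
have mG : measurable_fun setT (fun z : X * measurableTypeR R => (z.1, F z)).
  by apply: measurable_fun_pair => //; exact: measurable_fst.
exists F; split=> // S mS.
rewrite -[RHS]/(law (mu \x unit_lebesgue R)%E mG S).
apply: cantor_prod_unique mS => A w mA; rewrite [RHS]lawE.
have [mw w0 iw wE] := pP w.
rewrite wE// integral_mkcond.
transitivity (\int[mu]_x (unit_lebesgue R)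
  (xsection ((fun z => (z.1, F z)) @^-1` (A `*` cylinder w)) x))%E; last by [].
apply: ae_eq_integral => //.
- apply/(measurable_restrictT _ mA).1; exact/measurable_funTS/measurable_EFinP.
- apply: measurable_fun_xsection; rewrite -[X in measurable X]setTI; apply: mG => //.
  by apply: measurableX => //; exact: measurable_cylinder.
move: consistent_ae; apply: filterS => x cx _; rewrite patchE.
case: ifPn => [/[!inE] xA|xA].
  rewrite /= -(branch_law w cx); congr (unit_lebesgue R _).
  by apply/seteqP; split=> u; rewrite /xsection /= inE => // -[].
rewrite (_ : xsection _ _ = set0) ?measure0//.
apply/seteqP; split=> u; last by [].
by rewrite /xsection /= inE => -[/= Ax _]; case/negP: xA; rewrite inE.
Qed.

End ProductWithCantor.

(** * Limits along ultrafilters and compactness of probabilities on binary sequences *)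

Section UltraLimits.
Context {R : realType} {I : Type} {G : set_system I} {GU : UltraFilter G}.

(** Compactness of the segment provides a cluster point, and a cluster point of an ultrafilter is a
    limit. *)
Lemma ultra_bounded_cvg (x : I -> R) (a b : R) : (forall i, a <= x i <= b) ->
  exists l : R, x i @[i --> G] --> l.
Proof.
move=> xab; have [|l [_ cl]] := @segment_compact R a b (fmap x G) _.
  by apply: (@filterE _ G) => i /=; rewrite in_itv /=; exact: xab.
exists l => V lV; have [//|GnV] := in_ultra_setVsetC (x @^-1` V) GU.
by have [y []] := cl (~` V) V GnV lV.
Qed.

End UltraLimits.

Section TailUniform.
Context {R : realType}.
Implicit Types f : cantor -> R.

(** Continuity for the product topology, whose basic neighbourhoods are the cylinders. *)
Definition tail_continuous f : Prop := forall (b : cantor) (e : R), 0 < e ->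
  exists n, forall b', initial_word b' n = initial_word b n -> `|f b' - f b| <= e.

Definition tail_uniform f : Prop := forall e : R, 0 < e ->
  exists n, forall b b', initial_word b' n = initial_word b n -> `|f b' - f b| <= e.

(* Heine-Cantor: a coordinatewise ultrafilter limit of a sequence of
   counterexamples contradicts continuity. *)
Lemma tail_continuous_uniform f : tail_continuous f -> tail_uniform f.
Proof.
move=> cf e e0; apply: contrapT => /forallNP nf.
have /choice[s sP] n : exists s : cantor * cantor,
    initial_word s.2 n = initial_word s.1 n /\ e < `|f s.2 - f s.1|.
  have /existsNP[b /existsNP[b' /not_implyP[bb' /negP]]] := nf n.
  by rewrite -ltNge => ?; exists (b, b').
have [G [GU ooG]] := ultraFilterLemma (@eventually_filter).
pose b : cantor := fun k => `[< G [set n | (s n).1 k] >].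
have Gb m : G [set n | initial_word (s n).1 m = initial_word b m].
  elim: m => [|m IH] /=; first exact: filterE.
  have Gm : G [set n | (s n).1 m = b m].
    rewrite /b; case: asboolP => [|nG]; first by apply: filterS => n /= ->.
    have [//|] := in_ultra_setVsetC (fun n => is_true ((s n).1 m)) GU.
    by apply: filterS => n /= /negP/negbTE.
  by apply: filterS2 IH Gm => n /= -> ->.
have e2 : 0 < e / 2 by rewrite divr_gt0.
have [m mP] := cf b _ e2.
have Gm : G [set n | (m <= n)%N] by apply: ooG; exact: nbhs_infty_ge.
have [n [/= sb mn]] := filter_ex (filterI (Gb m) Gm).
have [s12 efs] := sP n.
have s2b : initial_word (s n).2 m = initial_word b m by rewrite -sb; exact: initial_le mn s12.
have := ler_distD (f b) (f (s n).2) (f (s n).1).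
by have := mP _ sb; have := mP _ s2b; rewrite (distrC (f b)); lra.
Qed.

(** A sample point of the cylinder of [w], padded with [false]; [rev] restores the chronological
    order of the letters. *)
Definition extend (w : seq bool) : cantor := fun k => nth false (rev w) k.

Lemma initial_extend w : initial_word (extend w) (size w) = w.
Proof.
elim: w => //= b w IH; congr cons.
  by rewrite /extend rev_cons nth_rcons size_rev ltnn eqxx.
rewrite -[RHS]IH; apply/initial_nth => k kw.
by rewrite /extend rev_cons nth_rcons size_rev kw.
Qed.

(** The sum is a step function: on each cylinder of length [n] it takes the value of [f] at the
    sample point, since only one term survives at [b]. *)
Lemma tail_uniform_approx f e : tail_uniform f -> 0 < e ->
  exists n, forall b, `|f b - \sum_(w : n.-tuple bool) f (extend w) * \1_(cylinder w) b| <= e.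
Proof.
move=> uf e0; have [n nP] := uf e e0; exists n => b.
pose w : n.-tuple bool := Tuple (introT eqP (size_initial b n)).
rewrite (bigD1 w)//= big1 ?addr0.
  rewrite indicE mem_set ?mulr1; last exact: initial_cylinder.
  apply: nP; have := initial_extend (initial_word b n); rewrite size_initial => ->.
  by [].
move=> v vw; rewrite indicE memNset ?mulr0// /cylinder /= size_tuple => bv.
by move/eqP: vw; apply; apply/val_inj.
Qed.

Lemma bm_tail_uniform f : tail_uniform f -> bounded_measurable f.
Proof.
move=> uf; split.
  apply: measurable_fun_gt => y; apply: measurable_cantor_open => b /= yb.
  have e0 : 0 < (f b - y) / 2 by rewrite divr_gt0// subr_gt0.
  have [n nP] := uf _ e0.
  exists n => b' /nP; rewrite ler_distl => /andP[? _]; lra.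
have [n nP] := tail_uniform_approx uf ltr01.
exists (1 + \sum_(w : n.-tuple bool) `|f (extend w)|) => b.
rewrite -[f b](subrK (\sum_(w : n.-tuple bool) f (extend w) * \1_(cylinder w) b)).
apply: le_trans (ler_normD _ _) (lerD (nP b) _).
apply: le_trans (ler_norm_sum _ _ _) _; apply: ler_sum => w _.
rewrite normrM ler_piMr// indicE; case: (_ \in _); by rewrite ?normr1 ?normr0.
Qed.

(** The error does not depend on [P], so convergence of finitely many cylinder masses controls the
    integrals. *)
Lemma tail_uniform_mean f e (P : probability cantor R) (n : nat) :
  tail_uniform f ->
  (forall b, `|f b - \sum_(w : n.-tuple bool) f (extend w) * \1_(cylinder w) b| <= e) ->
  `|\int[P]_b f b - \sum_(w : n.-tuple bool) f (extend w) * fine (P (cylinder w))| <= e.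
Proof.
move=> uf fe.
have bw (w : n.-tuple bool) : bounded_measurable (fun b : cantor =>
    f (extend w) * \1_(cylinder w) b).
  by apply: bmZ; apply: bm_indic; exact: measurable_cylinder.
have -> : \sum_(w : n.-tuple bool) f (extend w) * fine (P (cylinder w)) =
    \int[P]_b (\sum_(w : n.-tuple bool) f (extend w) * \1_(cylinder w) b).
  rewrite mean_sum//; apply: eq_bigr => w _.
  rewrite meanZ; last by apply: bm_indic; exact: measurable_cylinder.
  by rewrite mean_indic//; exact: measurable_cylinder.
have bf := bm_tail_uniform uf.
rewrite -meanB//; last exact: bm_sum.
have bd : bounded_measurable (fun b => f b - \sum_(w : n.-tuple bool)
    f (extend w) * \1_(cylinder w) b) by apply: bmB => //; exact: bm_sum.
rewrite ler_norml; apply/andP; split.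
  rewrite -(mean_cst P (- e)); apply: mean_le => //; first exact: bm_cst.
  by move=> b; have := fe b; rewrite ler_norml => /andP[].
rewrite -[leRHS](mean_cst P e); apply: mean_le => //; first exact: bm_cst.
by move=> b; have := fe b; rewrite ler_norml => /andP[].
Qed.

(** Every cylinder mass converges along [G] and consistency passes to the limit, so [branch]
    realises the limits as masses of a probability. Step functions carry the convergence over to
    integrals. *)
Lemma cantor_prob_compact I (G : set_system I) (GU : UltraFilter G)
    (g : I -> probability cantor R) :
  exists Q : probability cantor R, forall f, tail_uniform f ->
    \int[g i]_b f b @[i --> G] --> \int[Q]_b f b.
Proof.
have mc := measurable_cylinder.
have /choice[p pP] (w : seq bool) :
    exists l, fine (g i (cylinder w)) @[i --> G] --> (l : R).
  apply: (@ultra_bounded_cvg _ _ _ _ _ 0 1) => i.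
  exact: fine_prob01.
have cp : consistent p.
  split=> [w||w].
  - apply: (cvgr_to_ge (pP w)); apply: filterE => i.
    by have /andP[] := fine_prob01 (g i) (mc w).
  - apply: (cvg_unique _ (pP [::])) => //.
    rewrite (_ : (fun _ => _) = cst 1); first exact: cvg_cst.
    apply/funext => i; have -> : cylinder [::] = setT by apply/seteqP; split.
    exact: fine_probT.
  - apply: (cvg_unique _ (pP w)) => //.
    rewrite (_ : (fun _ => _) = (fun i => fine (g i (cylinder (false :: w))) +
        fine (g i (cylinder (true :: w))))); first exact: cvgD.
    apply/funext => i; rewrite -fine_probU//.
      congr (fine (g i _)); apply/seteqP; split=> b; last by move=> [] [_].
      move=> bw; have : cylinder (b (size w) :: w) b.
        by rewrite /cylinder /= [X in _ :: X]bw.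
      by case: (b (size w)) => ?; [right|left].
    apply/seteqP; split=> // b []; rewrite /cylinder /=.
    by move=> [->].
pose F := fun u : measurableTypeR R => branch p (u : R).
have mF : measurable_fun setT F.
  apply: (@measurable_branch R _ (measurableTypeR R) (fun w _ => p w)) => [w|].
    exact: measurable_cst.
  exact: measurable_id.
exists (law (unit_lebesgue R) mF) => f uf.
have Qw w : law (unit_lebesgue R) mF (cylinder w) = (p w)%:E.
  by rewrite lawE; exact: branch_law.
apply/cvgrPdist_le => e e0.
(* Two thirds pay for replacing [f] by a step function under the limit and under [g i], the last one
   for the finite sums of masses. *)
have e3 : 0 < e / 3 by rewrite divr_gt0.
have [n nP] := tail_uniform_approx uf e3.
have cvgS : \sum_(w : n.-tuple bool) f (extend w) * fine (g i (cylinder w)) @[i --> G]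
    --> \sum_(w : n.-tuple bool) f (extend w) * p w.
  apply: cvg_big => [|w _]; first exact: add_continuous.
  apply: cvgMr; exact: pP.
move/cvgrPdist_le : cvgS => /(_ _ e3); apply: filterS => i.
have := tail_uniform_mean (g i) uf nP.
have := tail_uniform_mean (law (unit_lebesgue R) mF) uf nP.
under eq_bigr do rewrite Qw /=.
rewrite !ler_distl; set A := \sum_(_ : _) _; set B := \sum_(_ : _) _.
move=> /andP[? ?] /andP[? ?] /andP[? ?]; apply/andP; split; lra.
Qed.

End TailUniform.

(** * The torus *)

Section DotProduct.
Context {R : realType} {d : nat}.
Implicit Types u v w : 'rV[R]_d.

Lemma dotvC u v : dotv u v = dotv v u.
Proof. by apply: eq_bigr => i _; rewrite mulrC. Qed.

Lemma dotvDl u v w : dotv (u + v) w = dotv u w + dotv v w.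
Proof. by rewrite -big_split; apply: eq_bigr => i _; rewrite !mxE mulrDl. Qed.

Lemma dotvZl c u v : dotv (c *: u) v = c * dotv u v.
Proof. by rewrite mulr_sumr; apply: eq_bigr => i _; rewrite !mxE mulrA. Qed.

Lemma dotvNl u v : dotv (- u) v = - dotv u v.
Proof. by rewrite -scaleN1r dotvZl mulN1r. Qed.

Lemma dotv_ge0 u : 0 <= dotv u u.
Proof. by apply: sumr_ge0 => i _; rewrite -expr2 sqr_ge0. Qed.

Lemma sqr_enorm u : enorm u ^+ 2 = dotv u u.
Proof. by rewrite sqr_sqrtr// dotv_ge0. Qed.

Lemma enorm_ge0 u : 0 <= enorm u.
Proof. exact: sqrtr_ge0. Qed.

Lemma enormN u : enorm (- u) = enorm u.
Proof. by rewrite /enorm dotvNl dotvC dotvNl opprK. Qed.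

Lemma enormZ c u : enorm (c *: u) = `|c| * enorm u.
Proof.
rewrite /enorm dotvZl dotvC dotvZl mulrA -expr2 sqrtrM ?sqr_ge0//.
by rewrite sqrtr_sqr.
Qed.

Lemma sqr_enormD u v :
  enorm (u + v) ^+ 2 = enorm u ^+ 2 + 2 * dotv u v + enorm v ^+ 2.
Proof.
rewrite !sqr_enorm dotvDl (dotvC u (u + v)) (dotvC v (u + v)) !dotvDl (dotvC v u).
ring.
Qed.

(** Expand the squared norms of [s u + v / s] and [s u - v / s], where [s] is the square root of
    [k]. *)
Lemma dotv_young (k : R) u v : 0 < k ->
  `|2 * dotv u v| <= k * enorm u ^+ 2 + k^-1 * enorm v ^+ 2.
Proof.
move=> k0; pose s := Num.sqrt k.
have s0 : 0 < s by rewrite sqrtr_gt0.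
have sk : s ^+ 2 = k by rewrite sqr_sqrtr// ltW.
have uvE (c : R) : c ^+ 2 = 1 ->
    enorm (s *: u + (c * s^-1) *: v) ^+ 2 =
    k * enorm u ^+ 2 + c * (2 * dotv u v) + k^-1 * enorm v ^+ 2.
  move=> c1; rewrite sqr_enormD !enormZ dotvZl dotvC dotvZl dotvC !exprMn.
  rewrite !real_normK ?num_real// exprMn c1 exprVn sk mul1r.
  by congr (_ + _ + _); field; rewrite gt_eqF.
have := sqr_ge0 (enorm (s *: u + (1 * s^-1) *: v)).
have := sqr_ge0 (enorm (s *: u + (-1 * s^-1) *: v)).
rewrite !uvE ?expr1n ?sqrrN ?expr1n// => ? ?.
by rewrite ler_norml; apply/andP; split; lra.
Qed.

Lemma coord_le_enorm u i : `|u 0 i| <= enorm u.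
Proof.
rewrite -ler_sqr ?nnegrE ?enorm_ge0 ?normr_ge0// sqr_enorm real_normK ?num_real//.
rewrite /dotv (bigD1 i)//= -expr2 lerDl.
by apply: sumr_ge0 => j _; rewrite -expr2 sqr_ge0.
Qed.

Lemma sqr_enorm_le u e : (forall i, `|u 0 i| <= e) -> enorm u ^+ 2 <= d%:R * e ^+ 2.
Proof.
move=> ue; rewrite sqr_enorm /dotv.
apply: (@le_trans _ _ (\sum_(i < d) e ^+ 2)).
  apply: ler_sum => i _; rewrite -expr2 -real_normK ?num_real//.
  by rewrite ler_sqr ?nnegrE// (le_trans _ (ue i)).
by rewrite sumr_const card_ord mulr_natl.
Qed.

Lemma measurable_coord i : measurable_fun [set: 'rV[R]_d] (fun v : 'rV[R]_d => v 0 i).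
Proof.
apply: measurable_fun_gt => y; apply: sub_sigma_algebra.
have := @coord_continuous R 1 d 0 i.
move/continuousP => /(_ `]y, +oo[%classic) /(_ (interval_open _ _)).
by rewrite set_itvoy; apply.
Qed.

Lemma continuous_sqr_enorm : continuous (fun v : 'rV[R]_d => enorm v ^+ 2).
Proof.
rewrite (_ : (fun _ => _) = fun v : 'rV[R]_d => \sum_(i < d) v 0 i * v 0 i).
  apply: continuous_big => [|i _]; first exact: add_continuous.
  have ci := @coord_continuous R 1 d 0 i.
  by move=> v; exact: (continuousM (ci v) (ci v)).
by apply/funext => v; exact: sqr_enorm.
Qed.

Lemma measurable_fun_dotv d' (X : measurableType d') (f g : X -> 'rV[R]_d) :
  measurable_fun setT f -> measurable_fun setT g ->
  measurable_fun setT (fun x => dotv (f x) (g x)).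
Proof.
move=> mf mg; apply: measurable_sum => i; apply: measurable_funM.
  exact: (measurableT_comp (measurable_coord i) mf).
exact: (measurableT_comp (measurable_coord i) mg).
Qed.

Lemma measurable_fun_sqr_enorm d' (X : measurableType d') (f : X -> 'rV[R]_d) :
  measurable_fun setT f -> measurable_fun setT (fun x => enorm (f x) ^+ 2).
Proof.
by move=> mf; under eq_fun do rewrite sqr_enorm; exact: measurable_fun_dotv.
Qed.

End DotProduct.

Section TorusNorm.
Context {R : realType} {d : nat}.
Local Notation T := (torus R d).
Local Notation E := 'rV[R]_d.
Local Notation pi := (\pi_(torus R d)).

Lemma torus_norm_le (v : E) : torus_norm (pi v) <= enorm v.
Proof.
apply: ge_inf; last by exists v.
by exists 0 => _ [w _ <-]; exact: enorm_ge0.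
Qed.

Lemma pi_add (v w : E) : pi (v + w) = pi v + pi w :> T.
Proof. exact: raddfD. Qed.

Lemma pi_opp (v : E) : pi (- v) = - pi v :> T.
Proof. exact: raddfN. Qed.

Lemma pi_eq (v w : E) : v - w \is a mxOver Num.int -> pi v = pi w.
Proof. by move=> vw; apply/eqP; rewrite -Quotient.idealrBE. Qed.

(** Fractional parts give a representative of norm at most the square root of [d]; the added 1 keeps
    the bound positive when [d = 0], so that it can be divided by. *)
Definition torus_bound : R := Num.sqrt d%:R + 1.

Lemma torus_bound_gt0 : 0 < torus_bound.
Proof. by rewrite ltr_wpDl// sqrtr_ge0. Qed.

Lemma torus_norm_bound (x : T) : torus_norm x <= torus_bound.
Proof.
rewrite -[x]reprK; set v := repr x.
pose w : E := \row_i (v 0 i - (Num.floor (v 0 i))%:~R).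
rewrite (@pi_eq v w); last first.
  by apply/mxOverP => i j; rewrite !mxE (ord1 i) opprB addrC subrK intr_int.
apply: le_trans (torus_norm_le w) _; rewrite ler_wpDr//.
rewrite -ler_sqr ?nnegrE ?enorm_ge0 ?sqrtr_ge0// [leRHS]sqr_sqrtr//.
have -> : d%:R = d%:R * 1 ^+ 2 :> R by rewrite expr1n mulr1.
apply: sqr_enorm_le => i.
rewrite mxE ger0_norm ?subr_ge0 ?floor_le_tmp//.
have := floorD1_gt (v 0 i); rewrite intrD; lra.
Qed.

End TorusNorm.
Arguments torus_bound : clear implicits.

Section MinimalRepresentative.
Context {R : realType} {d : nat}.
Local Notation T := (torus R d).
Local Notation E := 'rV[R]_d.
Local Notation pi := (\pi_(torus R d)).
Variables (r : T * T -> E) (r_minimal : minimal_representative r).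

Lemma pi_r x y : pi (r (x, y)) = y - x.
Proof. by have [_ /(_ x y)[]] := r_minimal. Qed.

Lemma enorm_r_torus_norm x y : enorm (r (x, y)) = torus_norm (y - x).
Proof. by have [_ /(_ x y)[]] := r_minimal. Qed.

(** The chosen representative of [x - 0] realises the infimum. *)
Lemma torus_norm_attained (x : T) : exists2 v : E, pi v = x & enorm v = torus_norm x.
Proof. by exists (r (0, x)); rewrite ?pi_r ?enorm_r_torus_norm ?subr0. Qed.

Lemma torus_norm_ge0 (x : T) : 0 <= torus_norm x.
Proof. by have [v _ <-] := torus_norm_attained x; exact: enorm_ge0. Qed.

Lemma torus_normN (x : T) : torus_norm (- x) = torus_norm x.
Proof.
have le (y : T) : torus_norm (- y) <= torus_norm y.
  have [v <- <-] := torus_norm_attained y.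
  by rewrite -(enormN v) -pi_opp; exact: torus_norm_le.
by apply/eqP; rewrite eq_le le/= -{1}[x]opprK le.
Qed.

Lemma enorm_r x y : enorm (r (x, y)) = torus_dist x y.
Proof. by rewrite enorm_r_torus_norm -torus_normN opprB. Qed.

Lemma enorm_r_bound z : enorm (r z) <= torus_bound R d.
Proof. by case: z => x y; rewrite enorm_r_torus_norm; exact: torus_norm_bound. Qed.

Lemma torus_dist_ge0 (x y : T) : 0 <= torus_dist x y.
Proof. by rewrite -enorm_r enorm_ge0. Qed.

Lemma measurable_r : measurable_fun [set: T * T] r.
Proof. by case: r_minimal. Qed.

(** Replace [v] by a shortest vector of its class, then absorb the cross term by Young's
    inequality. *)
Lemma sqr_torus_norm_pi (k : R) (v h : E) : 0 < k ->
  torus_norm (pi (v + h)) ^+ 2 <=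
    (1 + k) * torus_norm (pi v) ^+ 2 + (1 + k^-1) * enorm h ^+ 2.
Proof.
move=> k0; have [w wv <-] := torus_norm_attained (pi v).
have -> : pi (v + h) = pi (w + h) by rewrite !pi_add wv.
apply: (@le_trans _ _ (enorm (w + h) ^+ 2)).
  by rewrite ler_sqr ?nnegrE ?enorm_ge0 ?torus_norm_ge0// torus_norm_le.
have := dotv_young w h k0; rewrite sqr_enormD ler_norml => /andP[_].
by lra.
Qed.

Lemma sqr_torus_norm_continuous (e : R) : 0 < e -> exists2 c : R, 0 < c &
  forall v w : E, enorm (w - v) ^+ 2 <= c ->
    `|torus_norm (pi w) ^+ 2 - torus_norm (pi v) ^+ 2| <= e.
Proof.
move=> e0; have B0 : 0 < torus_bound R d := torus_bound_gt0.
set B := torus_bound R d in B0.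
(* With this [k] the term [k * B ^+ 2] equals [e / 2]; the modulus given below leaves the other half
   to the increment. *)
pose k := e / 2 / B ^+ 2; have k0 : 0 < k by rewrite !divr_gt0 ?exprn_gt0.
have K0 : 0 < 1 + k^-1 by rewrite addr_gt0 ?invr_gt0.
exists (e / 2 / (1 + k^-1)); first by rewrite !divr_gt0.
have le (v w : E) : enorm (w - v) ^+ 2 <= e / 2 / (1 + k^-1) ->
    torus_norm (pi w) ^+ 2 <= torus_norm (pi v) ^+ 2 + e.
  move=> wv; have := sqr_torus_norm_pi v (w - v) k0.
  rewrite addrC subrK => /le_trans; apply.
  rewrite mulrDl mul1r -addrA lerD2l [leRHS]splitr lerD//; last first.
    by rewrite mulrC -ler_pdivlMr.
  rewrite [leRHS](_ : _ = k * B ^+ 2); last by rewrite /k divfK// gt_eqF ?exprn_gt0.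
  rewrite ler_pM2l// ler_sqr ?nnegrE ?torus_norm_ge0 ?torus_norm_bound//.
  exact: ltW.
move=> v w wv; rewrite ler_distl lerBlDr; apply/andP; split; apply: le => //.
by rewrite -enormN opprB.
Qed.

End MinimalRepresentative.

(** * Coding the torus by binary sequences *)

Section DyadicExpansion.
Context {R : realType}.

(** Masses of repeated halving: [branch dyadic u] is the binary expansion of [u]. *)
Definition dyadic (w : seq bool) : R := 2^-1 ^+ size w.

Lemma dyadic_consistent : consistent dyadic.
Proof.
split=> [w||w]; rewrite /dyadic ?exprn_ge0 ?invr_ge0//.
by rewrite /= exprS; set x := _ ^+ _; lra.
Qed.

Lemma half_expr_small (e : R) : 0 < e -> exists n, 2^-1 ^+ n < e :> R.
Proof.
move=> e0; have lt1 : `|2^-1 : R| < 1 by rewrite ger0_norm// invf_lt1// ltr1n.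
have /cvgr0Pnorm_lt /(_ e e0) := cvg_expr lt1.
move=> /filter_ex[n]; rewrite ger0_norm ?exprn_ge0// => ?.
by exists n.
Qed.

Definition binary_value (b : cantor) : R :=
  sup (range (fun n => left_end dyadic (initial_word b n))).

Lemma left_end_nested (b : cantor) m n : (m <= n)%N ->
  left_end dyadic (initial_word b m) <= left_end dyadic (initial_word b n) /\
  left_end dyadic (initial_word b n) + 2^-1 ^+ n <=
    left_end dyadic (initial_word b m) + 2^-1 ^+ m.
Proof.
move=> /subnK <-; elim: (n - m)%N => [//|k [IH1 IH2]].
rewrite addSn /=; set L := left_end _ _ in IH1 IH2 *.
have h0 : 0 <= 2^-1 ^+ (k + m).+1 :> R by rewrite exprn_ge0.
have hS : 2^-1 ^+ (k + m) = 2^-1 ^+ (k + m).+1 + 2^-1 ^+ (k + m).+1 :> R.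
  by rewrite exprS; set x := _ ^+ _; lra.
rewrite /dyadic /= size_initial; rewrite hS in IH2.
by case: (b (k + m)%N); split; lra.
Qed.

Lemma binary_value_bounds (b : cantor) n :
  left_end dyadic (initial_word b n) <= binary_value b <=
    left_end dyadic (initial_word b n) + 2^-1 ^+ n.
Proof.
have ub : ubound (range (fun n => left_end dyadic (initial_word b n)))
    (left_end dyadic (initial_word b n) + 2^-1 ^+ n).
  move=> _ [m _ <-]; have [mn|/ltnW nm] := leqP m n.
    by apply: le_trans (left_end_nested b mn).1 _; rewrite lerDl exprn_ge0.
  by apply: le_trans (left_end_nested b nm).2; rewrite lerDl exprn_ge0.
apply/andP; split; last by apply: ge_sup => //; exists (left_end dyadic (initial_word b n)), n.
by apply: ub_le_sup; [exists (left_end dyadic (initial_word b n) + 2^-1 ^+ n)|exists n].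
Qed.

(** For every [n], both numbers lie in the same closed dyadic interval of length [2^-1 ^+ n]. *)
Lemma binary_value_branch (u : R) : 0 <= u < 1 -> binary_value (branch dyadic u) = u.
Proof.
move=> u01; apply/eqP; rewrite -subr_eq0 -normr_le0 leNgt; apply/negP.
move=> /half_expr_small[n]; apply/negP; rewrite -leNgt.
have := binary_value_bounds (branch dyadic u) n.
have := (branch_wordP (initial_word (branch dyadic u) n) dyadic_consistent u01).1.
rewrite !size_initial -initial_branch => /(_ erefl).
rewrite [dyadic _]/dyadic size_initial.
rewrite ler_norml => /andP[? ?] /andP[? ?].
by apply/andP; split; lra.
Qed.

Lemma binary_value_close (b b' : cantor) n : initial_word b' n = initial_word b n ->
  `|binary_value b' - binary_value b| <= 2^-1 ^+ n.
Proof.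
have := binary_value_bounds b n; have := binary_value_bounds b' n.
move=> + + bb'; rewrite bb' ler_norml => /andP[? ?] /andP[? ?].
by apply/andP; split; lra.
Qed.

End DyadicExpansion.

Section TorusCode.
Context {R : realType} {d : nat}.
Local Notation T := (torus R d).
Local Notation E := 'rV[R]_d.
Local Notation pi := (\pi_(torus R d)).
Local Notation B := (torus_bound R d).

(** Coordinate [i] is read from the bits at the positions [pickle (n, i)] and stretched to cover
    [[- B, B]]. The length [2 * B + 1] rather than [2 * B] keeps [unit_coordinate] strictly below 1,
    as [binary_value_branch] requires. *)
Definition decode_vector (b : cantor) : E :=
  \row_i ((2 * B + 1) * binary_value (fun n => b (pickle (n, i))) - B).

Definition decode (b : cantor) : T := pi (decode_vector b).

Lemma decode_vector_close (e : R) : 0 < e -> exists N, forall b b',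
  initial_word b' N = initial_word b N ->
  forall i, `|decode_vector b' 0 i - decode_vector b 0 i| <= e.
Proof.
have B0 : 0 < B := torus_bound_gt0.
move=> e0; have [|n ne] := @half_expr_small R (e / (2 * B + 1)).
  by rewrite divr_gt0// addr_gt0// mulr_gt0.
(* [N] exceeds the positions of the first [n] bits of all coordinates. *)
pose N := (\max_(k < n) \max_(i < d) pickle (k : nat, i)).+1.
exists N => b b' /initial_nth bb' i; rewrite !mxE opprB addrA subrK.
rewrite -mulrBr normrM ger0_norm ?addr_ge0 ?mulr_ge0 ?(ltW B0)// mulrC.
rewrite -ler_pdivlMr ?addr_gt0 ?mulr_gt0//.
apply: le_trans (ltW ne); apply: binary_value_close; apply/initial_nth => k kn.
apply: bb'; rewrite ltnS.
apply: leq_trans (leq_bigmax (Ordinal kn)).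
exact: (leq_bigmax i).
Qed.

Lemma decode_open (A : set T) (b : cantor) : open A -> A (decode b) ->
  exists N, forall b', initial_word b' N = initial_word b N -> A (decode b').
Proof.
move=> oA Ab; have : nbhs (decode_vector b) (pi @^-1` A).
  exact: open_nbhs_nbhs.
move=> /nbhs_ballP[e /= e0 eA].
have e2 : 0 < e / 2 by rewrite divr_gt0.
have [N NP] := decode_vector_close e2; exists N => b' bb'; apply: eA; split=> // i j.
rewrite (ord1 i) /ball /= distrC; apply: le_lt_trans (NP _ _ bb' j) _.
by rewrite ltr_pdivrMr// ltr_pMr// ltr1n.
Qed.

Lemma measurable_decode : measurable_fun [set: cantor] decode.
Proof.
apply: (@measurability _ _ cantor T setT decode (@open T)) => // _ [A oA <-].
rewrite setTI; apply: measurable_cantor_open => b Ab.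
exact: decode_open.
Qed.

Variables (r : T * T -> E) (r_minimal : minimal_representative r).

Definition unit_coordinate (x : T) (i : 'I_d) : R := (r (0, x) 0 i + B) / (2 * B + 1).

(** A measurable section of [decode], made of the bits of the minimal representative of [x]. *)
Definition encode (x : T) : cantor := fun m =>
  if (unpickle m : option (nat * 'I_d)) is Some (n, i)
  then branch dyadic (unit_coordinate x i) n else false.

Lemma encodeK : cancel encode decode.
Proof.
move=> x; have B0 : 0 < B := torus_bound_gt0.
have B2 : 0 < 2 * B + 1 by rewrite addr_gt0 ?mulr_gt0.
rewrite /decode (_ : decode_vector _ = r (0, x)) ?pi_r ?subr0//.
apply/rowP => i; rewrite mxE.
rewrite (_ : (fun _ => _) = branch dyadic (unit_coordinate x i)); last first.
  by apply/funext => n; rewrite /encode pickleK.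
rewrite binary_value_branch /unit_coordinate; last first.
  have := le_trans (coord_le_enorm (r (0, x)) i) (enorm_r_bound r_minimal (0, x)).
  rewrite ler_norml => /andP[? ?].
  rewrite ler_pdivlMr// mul0r ltr_pdivrMr// mul1r.
  by apply/andP; split; lra.
by rewrite mulrC divfK ?gt_eqF// addrK.
Qed.

Lemma measurable_encode : measurable_fun [set: T] encode.
Proof.
apply: measurable_fun_cantor => m; rewrite /encode.
case: (unpickle m : option (nat * 'I_d)) => [[n i]|]; last exact: measurable_cst.
suff mb : measurable_fun setT (fun x : T => branch dyadic (unit_coordinate x i)).
  exact: (measurableT_comp (measurable_bit n) mb).
apply: (@measurable_branch R _ T (fun w _ => dyadic w)) => [w|].
  exact: measurable_cst.
rewrite /unit_coordinate; apply: measurable_funM => //; apply: measurable_funD => //.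
apply: (measurableT_comp (measurable_coord i)).
apply: (measurableT_comp (measurable_r r_minimal)).
exact: measurable_pair1.
Qed.

End TorusCode.

Section Interleave.

Definition evens (b : cantor) : cantor := fun n => b n.*2.
Definition odds (b : cantor) : cantor := fun n => b n.*2.+1.
Definition interleave (b c : cantor) : cantor :=
  fun n => if odd n then c n./2 else b n./2.

Lemma evens_interleave b c : evens (interleave b c) = b.
Proof. by apply/funext => n; rewrite /evens /interleave odd_double doubleK. Qed.

Lemma odds_interleave b c : odds (interleave b c) = c.
Proof.
by apply/funext => n; rewrite /odds /interleave /= odd_double /= uphalf_double.
Qed.

Lemma initial_evens_odds b b' n : initial_word b' n.*2 = initial_word b n.*2 ->
  initial_word (evens b') n = initial_word (evens b) n /\
  initial_word (odds b') n = initial_word (odds b) n.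
Proof.
move=> /initial_nth bb'; split; apply/initial_nth => k kn; apply: bb'.
  by rewrite ltn_double.
by rewrite ltn_Sdouble.
Qed.

Lemma measurable_evens : measurable_fun [set: cantor] evens.
Proof. by apply: measurable_fun_cantor => n; exact: measurable_bit. Qed.

Lemma measurable_odds : measurable_fun [set: cantor] odds.
Proof. by apply: measurable_fun_cantor => n; exact: measurable_bit. Qed.

Lemma measurable_interleave d (X : measurableType d) (f g : X -> cantor) :
  measurable_fun [set: X] f -> measurable_fun [set: X] g ->
  measurable_fun [set: X] (fun x => interleave (f x) (g x)).
Proof.
move=> mf mg; apply: measurable_fun_cantor => n; rewrite /interleave.
by case: (odd n); [exact: (measurableT_comp (measurable_bit n./2) mg)|
  exact: (measurableT_comp (measurable_bit n./2) mf)].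
Qed.

End Interleave.

(** * Compactness and disintegration of measures on pairs of torus points *)

Section TorusProbability.
Context {R : realType} {d : nat}.
Local Notation T := (torus R d).
Local Notation E := 'rV[R]_d.
Local Notation pi := (\pi_(torus R d)).
Local Notation I := (measurableTypeR R).
Local Notation lambda := (unit_lebesgue R).

Definition decode_pair (b : cantor) : T * T := (decode (evens b), decode (odds b)).

Lemma measurable_decode_pair : measurable_fun [set: cantor] decode_pair.
Proof.
apply: measurable_fun_pair.
  exact: (measurableT_comp measurable_decode measurable_evens).
exact: (measurableT_comp measurable_decode measurable_odds).
Qed.

Lemma tail_continuous_decode (h : T -> R) : continuous h ->
  tail_continuous (h \o decode).
Proof.
move=> ch b e e0.
have oA : open (h @^-1` ball (h (decode b)) e).
  by apply: open_comp => [x _|]; [exact: ch|exact: ball_open].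
have [N NP] := decode_open oA (ballxx _ e0).
by exists N => b' /NP; rewrite /= distrC => /ltW.
Qed.

(** Compactness of the torus enters through the code: [h \o decode] is tail-uniform, hence bounded
    and measurable, and composing with [encode] gives [h] back. *)
Lemma bm_continuous (r : T * T -> E) (h : T -> R) : minimal_representative r ->
  continuous h -> bounded_measurable h.
Proof.
move=> rm /tail_continuous_decode/tail_continuous_uniform/bm_tail_uniform bh.
have -> : h = (fun x => (h \o decode) (encode r x)).
  by apply/funext => x; rewrite /= (encodeK rm).
exact: bm_comp (measurable_encode rm) bh.
Qed.

Variables (r : T * T -> E) (r_minimal : minimal_representative r).

Lemma measurable_continuous_prod (f : T * E -> R) : continuous f ->
  measurable_fun [set: T * E] f.
Proof.
move=> cf; apply: measurable_fun_gt => y.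
pose W w : set E := \bigcup_(B in [set B : set E | open B /\
  forall b z, cylinder w b -> B z -> y < f (decode b, z)]) B.
(* No second countability is needed on the [E] side: the cylinders on the torus
   side are countable and each [W w] is open. *)
rewrite (_ : mkset _ = \bigcup_w (encode r @^-1` cylinder w `*` W w)).
  apply: (@word_bigcup_measurable _ (T * E)%type) => w _; apply: measurableX.
    rewrite -[X in measurable X]setTI; apply: (measurable_encode r_minimal) => //.
    exact: measurable_cylinder.
  apply: sub_sigma_algebra; apply: bigcup_open => B [] //.
apply/seteqP; split=> [[x z] /= yf|[x z] [w _ [/= xw [B [oB BP] Bz]]]]; last first.
  by rewrite /= -(encodeK r_minimal x); exact: BP.
have : nbhs (x, z) [set q | y < f q].
  apply: (cf (x, z) [set u | y < u]).
  rewrite -set_itvoy; apply: open_nbhs_nbhs; split; first exact: interval_open.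
  by rewrite /= in_itv /= yf.
move=> [[A B] [/= Ax Bz] AB].
move: Ax Bz; rewrite !nbhsE => -[A' [oA' A'x] A'A] [B' [oB' B'z] B'B].
rewrite -(encodeK r_minimal x) in A'x.
have [N NP] := decode_open oA' A'x.
exists (initial_word (encode r x) N) => //; split=> /=; first exact: initial_cylinder.
exists B' => //; split=> // b z'; rewrite /cylinder /= size_initial => /NP bA B'z'.
by apply: (AB (decode b, z')); split; [exact: A'A|exact: B'B].
Qed.

(** Encode both points into one interleaved sequence, take the limit there and decode it. The
    encoding cancels in the integrals, so continuity is asked of [h \o decode_pair] alone. *)
Lemma torus_coupling_compact (J : Type) (G : set_system J) (GU : UltraFilter G)
    (g : J -> probability (T * T)%type R) :
  exists Q : probability (T * T)%type R, forall h : T * T -> R,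
    bounded_measurable h -> tail_continuous (h \o decode_pair) ->
    \int[g j]_q h q @[j --> G] --> \int[Q]_q h q.
Proof.
pose enc (q : T * T) := interleave (encode r q.1) (encode r q.2).
have encK q : decode_pair (enc q) = q.
  by case: q => x y; rewrite /decode_pair evens_interleave odds_interleave
    !(encodeK r_minimal).
have menc : measurable_fun setT enc.
  have me := measurable_encode r_minimal.
  apply: measurable_interleave.
    by apply: (measurableT_comp me); exact: measurable_fst.
  by apply: (measurableT_comp me); exact: measurable_snd.
have [Q QP] := cantor_prob_compact GU (fun j => law (g j) menc).
exists (law Q measurable_decode_pair) => h bh ch.
have uh := tail_continuous_uniform ch.
rewrite mean_law//; have := QP _ uh.
rewrite (_ : (fun _ => _) = (fun j => \int[g j]_q h q))//.
apply/funext => j; rewrite mean_law; last exact: bm_tail_uniform.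
by apply: eq_Rintegral => q _; rewrite /= encK.
Qed.

(** Only the second point is encoded; [cantor_disintegration] applies and its random map is
    decoded. *)
Lemma torus_disintegration (g : probability (T * T)%type R) (mu : probability T R) :
  (forall A, measurable A -> g (fst @^-1` A) = mu A) ->
  exists F : T * I -> T, measurable_fun [set: T * I] F /\
    forall h : T * T -> R, bounded_measurable h ->
      \int[g]_q h q = \int[mu]_x \int[lambda]_u h (x, F (x, u)).
Proof.
move=> gmu.
have me : measurable_fun [set: T * T] (fun q : T * T => (q.1, encode r q.2)).
  apply: measurable_fun_pair; first exact: measurable_fst.
  by apply: (measurableT_comp (measurable_encode r_minimal)); exact: measurable_snd.
have [F [mF FP]] := cantor_disintegration (law g me).
have mG : measurable_fun setT (fun z : T * I => (z.1, F z)).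
  by apply: measurable_fun_pair => //; exact: measurable_fst.
exists (fun z => decode (F z)); split.
  exact: (measurableT_comp measurable_decode mF).
move=> h bh.
pose k (q : T * cantor) := h (q.1, decode q.2).
have bk : bounded_measurable k.
  apply: bm_comp bh; apply: measurable_fun_pair; first exact: measurable_fst.
  by apply: (measurableT_comp measurable_decode); exact: measurable_snd.
transitivity (\int[law g me]_q k q).
  rewrite mean_law//; apply: eq_Rintegral => -[x y] _.
  by rewrite /k /= (encodeK r_minimal).
rewrite (@eq_mean _ _ _ _ (law (law (law g me) measurable_fst \x lambda)%E mG)) //.
rewrite mean_law//.
have bkG := bm_comp mG bk.
rewrite (bm_fubini _ _ bkG).2; apply: eq_mean => A mA.
by rewrite -gmu.
Qed.

End TorusProbability.

(** * The topology of probability measures *)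

Lemma initial_cvg (S : choiceType) (Y : topologicalType) (f : S -> Y)
    (F : set_system S) (s : S) : Filter F ->
  f @ F --> f s -> F --> (s : initial_topology f).
Proof.
move=> FF fs V /=; rewrite nbhsE => -[_ [[A oA <-] As] AV].
by apply: filterS AV _; apply: (fs A); exact: open_nbhs_nbhs.
Qed.

Section ProbTopology.
Context {R : realType} {d : nat}.
Local Notation T := (torus R d).
Local Notation E := 'rV[R]_d.

(** The weak topology is initial for [integrate_continuous], whose target carries the topology of
    pointwise convergence, itself a supremum of initial topologies. *)
Lemma prob_cvg (J : Type) (G : set_system J) (FG : Filter G)
    (m : J -> prob R d) (mu : prob R d) :
  (forall h : T -> R, continuous h ->
    \int[m j]_x h x @[j --> G] --> \int[mu]_x h x) ->
  m j @[j --> G] --> mu.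
Proof.
move=> mh.
apply: (@initial_cvg _ _ (@integrate_continuous R d) (m @ G)).
apply/cvg_sup => -[h ch].
apply: (@initial_cvg _ _ _ ((@integrate_continuous R d \o m) @ G)).
exact: mh.
Qed.

(** Semicontinuity along a filter. Neighbourhoods are those of the subspace of nonnegative times,
    whence the sign conditions on [t] and [t0]. *)
Lemma usc_eventually (U : R -> prob R d -> R) (J : Type) (G : set_system J)
    (FG : Filter G) (t : J -> R) (m : J -> prob R d) (t0 : R) (mu : prob R d) (a : R) :
  usc (time_space (R := R) (d := d)) (fun q => U q.1 q.2) ->
  t j @[j --> G] --> t0 -> m j @[j --> G] --> mu ->
  G [set j | 0 <= t j] -> 0 <= t0 -> U t0 mu < a ->
  G [set j | U (t j) (m j) < a].
Proof.
move=> uscU tt0 mmu t_ge0 t0_ge0 Ua.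
have [|V V0 VP] := uscU (t0, mu) (- a) _; first by rewrite lte_fin ltrN2.
have tmV : (fun j => (t j, m j)) @ G --> (t0, mu) by exact: (cvg_pair tt0 mmu).
move: V0; rewrite /nbhs /= -nbhs_subspace_in //= => V0.
have GV : G [set j | time_space (t j, m j) -> V (t j, m j)] := tmV _ V0.
apply: filterS (filterI t_ge0 GV) => j [tj Vj].
by have := VP _ (Vj tj); rewrite lte_fin ltrN2.
Qed.

End ProbTopology.

(** * The transport cost *)

Section Cost.
Context {R : realType} {d : nat}.
Local Notation T := (torus R d).
Local Notation E := 'rV[R]_d.
Local Notation pi := (\pi_(torus R d)).
Variables (r : T * T -> E) (r_minimal : minimal_representative r).

(** The distance is the length of [r], from which it inherits measurability and the bound. *)
Lemma bm_cost : bounded_measurable (fun q : T * T => torus_dist q.1 q.2 ^+ 2).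
Proof.
have -> : (fun q : T * T => torus_dist q.1 q.2 ^+ 2) = (fun q => enorm (r q) ^+ 2).
  by apply/funext => -[x y]; rewrite (enorm_r r_minimal).
split; first exact: measurable_fun_sqr_enorm (measurable_r r_minimal).
exists (torus_bound R d ^+ 2) => q; rewrite ger0_norm ?sqr_ge0//.
by rewrite ler_sqr ?nnegrE ?enorm_ge0 ?enorm_r_bound// ltW// torus_bound_gt0.
Qed.

Lemma tail_continuous_cost :
  tail_continuous ((fun q : T * T => torus_dist q.1 q.2 ^+ 2) \o decode_pair).
Proof.
move=> b e e0; have [c c0 cP] := sqr_torus_norm_continuous r_minimal e0.
(* If each decoded point moves by at most [k] per coordinate, their difference moves by at most
   [2 * k]; dividing by [d + 1] also covers [d = 0]. *)
have [k k0 kc] : exists2 k : R, 0 < k & d%:R * (2 * k) ^+ 2 <= c.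
  have d1 : 0 < d%:R + 1 :> R by rewrite ltr_wpDl.
  have cd : 0 < c / (d%:R + 1) by rewrite divr_gt0.
  exists (Num.sqrt (c / (d%:R + 1)) / 2); first by rewrite divr_gt0// sqrtr_gt0.
  rewrite [2 * _]mulrC divfK// sqr_sqrtr ?(ltW cd)// mulrCA ger_pMr//.
  by rewrite ler_pdivrMr// mul1r lerDl.
have [N NP] := @decode_vector_close R d _ k0.
exists N.*2 => b' /initial_evens_odds[bE bO].
rewrite /= /torus_dist /decode -!pi_opp -!pi_add; apply: cP.
apply: le_trans kc; apply: sqr_enorm_le => i.
have := NP _ _ bE i; have := NP _ _ bO i.
set u := decode_vector _; set v := decode_vector _.
set u' := decode_vector _; set v' := decode_vector _.
rewrite !mxE !ler_norml => /andP[? ?] /andP[? ?].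
by apply/andP; split; lra.
Qed.

Lemma transport_cost_ge0 (g : probability (T * T)%type R) : 0 <= transport_cost g.
Proof. by apply: Rintegral_ge0 => q _; exact: sqr_ge0. Qed.

Lemma sqr_W2_le (mu nu : prob R d) (g : probability (T * T)%type R) :
  couplings mu nu g -> W2 mu nu ^+ 2 <= transport_cost g.
Proof.
move=> cg; have lb : has_lbound [set transport_cost g' | g' in couplings mu nu].
  by exists 0 => _ [g' _ <-]; exact: transport_cost_ge0.
rewrite /W2 sqr_sqrtr; first by apply: ge_inf => //; exists g.
apply: lb_le_inf; first by exists (transport_cost g), g.
by move=> _ [g' _ <-]; exact: transport_cost_ge0.
Qed.

Lemma W2_ge0 (mu nu : prob R d) : 0 <= W2 mu nu.
Proof. exact: sqrtr_ge0. Qed.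

End Cost.

(** * Superdifferentials of penalized functions *)

Section RandomizedMap.
Context d d' (X : measurableType d) (Y : measurableType d') (R : realType).
Local Notation I := (measurableTypeR R).
Variables (k : X * I -> Y) (mk : measurable_fun [set: X * I] k).

Lemma measurable_randomized x : measurable_fun [set: I] (fun u => k (x, u)).
Proof. by apply: (measurableT_comp mk); exact: measurable_pair1. Qed.

Definition randomized_law (x : X) : probability Y R :=
  law (unit_lebesgue R) (measurable_randomized x).

Lemma measurable_randomized_law :
  measurable_fun [set: X] (randomized_law : X -> pprobability Y R).
Proof.
apply: (@measurability _ _ X (pprobability Y R) setT _ (@pset _ Y R)) => //.
move=> _ [_ [c _ [A mA <-]] <-]; rewrite setTI.
rewrite (_ : _ @^-1` _ = [set x |
    (unit_lebesgue R \o xsection (k @^-1` A)) x < c%:E]%E); last first.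
  have xsE x : xsection (k @^-1` A) x = (fun u => k (x, u)) @^-1` A.
    by apply/seteqP; split=> u; rewrite /xsection /= inE.
  by apply/seteqP; split=> x; rewrite /preimage /mset /mkset /= xsE.
rewrite -[X in measurable X]setTI; apply: emeasurable_fun_infty_o => //.
apply: measurable_fun_xsection; rewrite -[X in measurable X]setTI; exact: mk.
Qed.

End RandomizedMap.

Section Indiscernible.
Context {R : realType} {d : nat}.
Local Notation T := (torus R d).

(* Measures that agree on measurable sets may still be different elements of
   [prob R d]; semicontinuity makes [U] blind to this, as the weak topology
   does not separate them. *)
Lemma usc_indiscernible (U : R -> prob R d -> R) (t : R) (mu nu : prob R d) :
  usc (time_space (R := R) (d := d)) (fun q => U q.1 q.2) -> 0 <= t ->
  (forall h : T -> R, continuous h -> \int[mu]_x h x = \int[nu]_x h x) ->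
  U t mu = U t nu.
Proof.
move=> uscU t0.
wlog le : mu nu / U t mu <= U t nu.
  by move=> H mn; have [/H|/ltW/H] := leP (U t mu) (U t nu);
    [exact|by move=> <- // h ch; rewrite mn].
move=> mn; apply/eqP; rewrite eq_le le leNgt; apply/negP => lt.
have : \oo [set _ : nat | U t nu < U t nu].
  apply: (@usc_eventually R d U nat \oo _ (fun=> t) (fun=> nu) t mu) => //.
  - exact: cvg_cst.
  - by apply: prob_cvg => h ch; rewrite mn//; exact: cvg_cst.
  - exact: filterE.
by move=> /filter_ex[n /=]; rewrite ltxx.
Qed.

Lemma usc_eq_prob (U : R -> prob R d -> R) (t : R) (mu nu : prob R d) :
  usc (time_space (R := R) (d := d)) (fun q => U q.1 q.2) -> 0 <= t ->
  (forall A : set T, measurable A -> mu A = nu A) -> U t mu = U t nu.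
Proof. by move=> uscU t0 mn; apply: usc_indiscernible => // h _; exact: eq_mean. Qed.

End Indiscernible.

Section Touching.
Context {R : realType} {d : nat}.
Local Notation T := (torus R d).
Local Notation E := 'rV[R]_d.
Local Notation pi := (\pi_(torus R d)).
Local Notation I := (measurableTypeR R).
Local Notation lambda := (unit_lebesgue R).
Variables (r : T * T -> E) (r_minimal : minimal_representative r).

(** A nonnegative function of zero integral vanishes almost everywhere, so [g] is carried by the
    diagonal. *)
Lemma cost_eq0 (g : probability (T * T)%type R) (h : T -> R) :
  transport_cost g = 0 -> measurable_fun [set: T] h ->
  \int[g]_q h q.1 = \int[g]_q h q.2.
Proof.
move=> g0 mh; have bc := bm_cost r_minimal.
have ic := bm_integrable g bc.
have : ae_eq g setT (EFin \o (fun q : T * T => torus_dist q.1 q.2 ^+ 2)) (cst 0%E).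
  apply/ae_eq_integral_abs => //; first by case/integrableP: ic.
  under eq_integral do rewrite /= ger0_norm ?sqr_ge0//.
  apply/eqP; rewrite -fine_eq0; first exact/eqP.
  exact: integrable_fin_num.
move=> ae0; congr fine; apply: ae_eq_integral => //.
- by apply/measurable_EFinP; apply: (measurableT_comp mh); exact: measurable_fst.
- by apply/measurable_EFinP; apply: (measurableT_comp mh); exact: measurable_snd.
move: ae0; apply: filterS => -[x y] /= /(_ Logic.I) [] /eqP; rewrite sqrf_eq0 => xy _.
suff -> : x = y by [].
move: xy; rewrite -(enorm_r r_minimal) => /eqP r0.
have rE : r (x, y) = 0.
  apply/rowP => i; rewrite mxE; apply/eqP; rewrite -normr_le0 -r0.
  exact: coord_le_enorm.
apply/esym/eqP; rewrite -subr_eq0 -(pi_r r_minimal) rE.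
by apply/eqP; exact: (raddf0 \pi_(torus R d)).
Qed.

Section Superdifferential.
Variables (b : T * T -> E) (mb : measurable_fun [set: T * T] b).
Hypothesis pi_b : forall x y, pi (b (x, y)) = x - y.
Hypothesis enorm_b : forall x y, enorm (b (x, y)) = torus_dist x y.

(** [b (x, y) + r (x, x')] represents [x' - y]; expand its squared norm. *)
Lemma sqr_dist_le x x' y :
  torus_dist x' y ^+ 2 <=
    enorm (b (x, y)) ^+ 2 + 2 * dotv (b (x, y)) (r (x, x')) + enorm (r (x, x')) ^+ 2.
Proof.
have -> : torus_dist x' y = torus_norm (pi (b (x, y) + r (x, x'))).
  rewrite pi_add pi_b (pi_r r_minimal) /torus_dist; congr torus_norm.
  by rewrite [RHS]addrC addrA subrK.
rewrite -sqr_enormD ler_sqr ?nnegrE ?enorm_ge0 ?(torus_norm_ge0 r_minimal)//.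
exact: torus_norm_le.
Qed.

Variables (F : T * I -> T) (mF : measurable_fun [set: T * I] F) (eps : R).
Hypothesis eps0 : 0 < eps.

Lemma measurable_scalev (c : R) : measurable_fun [set: E] ( *:%R c : E -> E).
Proof.
apply: (@measurability _ _ E E setT _ (@open E)) => // _ [A oA <-].
apply: sub_sigma_algebra; rewrite setTI.
by move: A oA; apply/continuousP => x; exact: scaler_continuous.
Qed.

Lemma measurable_graph : measurable_fun [set: T * I] (fun z => (z.1, F z)).
Proof. by apply: measurable_fun_pair => //; exact: measurable_fst. Qed.

(** The momentum at [x] created by the random partner [F (x, u)]. *)
Definition slope (z : T * I) : E := eps^-1 *: b (z.1, F z).

Lemma measurable_slope : measurable_fun [set: T * I] slope.
Proof.
apply: (measurableT_comp (measurable_scalev eps^-1)).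
exact: (measurableT_comp mb measurable_graph).
Qed.

Lemma enorm_scaled x y : enorm (eps^-1 *: b (x, y)) <= torus_bound R d / eps.
Proof.
rewrite enormZ ger0_norm ?invr_ge0 ?(ltW eps0)// mulrC.
rewrite ler_pM2r ?invr_gt0// enorm_b; exact: torus_norm_bound.
Qed.

Lemma enorm_slope z : enorm (slope z) <= torus_bound R d / eps.
Proof. exact: enorm_scaled. Qed.

Local Notation psi := (randomized_law measurable_slope).

(** The open set of vectors longer than [torus_bound R d / eps] is null for [psi x]. The extra 1
    passes from the closed ball to the open ball of [superdiff]. *)
Lemma msupport_slope x :
  msupport (psi x) `<=` [set z | enorm z < torus_bound R d / eps + 1].
Proof.
move=> z zs /=; rewrite ltNge; apply/negP => zb.
have K0 : 0 <= torus_bound R d / eps by rewrite divr_ge0 ?ltW// torus_bound_gt0.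
pose A : set E := [set w | (torus_bound R d / eps) ^+ 2 < enorm w ^+ 2].
have oA : open A.
  have /continuousP := @continuous_sqr_enorm R d.
  move=> /(_ `](torus_bound R d / eps) ^+ 2, +oo[%classic) /(_ (interval_open _ _)).
  by rewrite set_itvoy; apply.
have : (0 < psi x A)%E.
  apply: zs => //.
  rewrite /A /= ltr_sqr ?nnegrE ?enorm_ge0//; apply: lt_le_trans zb.
  by rewrite ltrDl.
rewrite /randomized_law lawE (_ : _ @^-1` _ = set0) ?measure0 ?ltxx//.
apply/seteqP; split=> u //=.
rewrite /A /= ltNge => /negP; apply.
by rewrite ler_sqr ?nnegrE ?enorm_ge0 ?enorm_slope.
Qed.

Lemma mean_slope (x : T) (h : E -> R) (M : R) : measurable_fun [set: E] h ->
  (forall z, enorm z <= torus_bound R d / eps -> `|h z| <= M) ->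
  \int[psi x]_z h z = \int[lambda]_u h (slope (x, u)).
Proof.
move=> mh hM; apply: mean_law_comp => //; split; last first.
  by exists M => u; apply: hM; exact: enorm_slope.
apply: (measurableT_comp mh); exact: measurable_randomized measurable_slope x.
Qed.

Variables (mu nu : prob R d) (g0 : probability (T * T)%type R).
Hypothesis g0P : couplings mu nu g0.
Hypothesis FP : forall h : T * T -> R, bounded_measurable h ->
  \int[g0]_q h q = \int[mu]_x \int[lambda]_u h (x, F (x, u)).

(** This turns the averaged Hamiltonian into an integral over the coupling, the form in which both
    viscosity inequalities are compared. *)
Lemma mean_slope_coupling (h : T * E -> R) (M : R) :
  measurable_fun [set: T * E] h ->
  (forall x z, enorm z <= torus_bound R d / eps -> `|h (x, z)| <= M) ->
  \int[mu]_x \int[psi x]_z h (x, z) = \int[g0]_q h (q.1, eps^-1 *: b q).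
Proof.
move=> mh hM; rewrite (@FP (fun q => h (q.1, eps^-1 *: b q))); last first.
  split; last first.
    exists M => -[x y]; apply: hM; exact: enorm_scaled.
  apply: (measurableT_comp mh); apply: measurable_fun_pair.
    exact: measurable_fst.
  exact: (measurableT_comp (measurable_scalev _) mb).
apply: eq_Rintegral => x _.
apply: (@mean_slope x (fun z => h (x, z)) M) => [|z]; last exact: hM.
by apply: (measurableT_comp mh); exact: measurable_pair1.
Qed.

(** Draw [(x, x')] from [g'] and [u] uniformly: [(x, F (x, u))] has law [g0], and [(x', F (x, u))]
    is the new coupling. Its cost comes from integrating [sqr_dist_le]; the factor [2 * eps] undoes
    the scaling of [slope]. *)
Lemma glued_coupling (mu' : prob R d) (g' : probability (T * T)%type R) :
  couplings mu mu' g' ->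
  exists2 g : probability (T * T)%type R, couplings mu' nu g &
    transport_cost g <= transport_cost g0 + transport_cost g' +
      2 * eps * \int[g']_xy \int[psi xy.1]_z dotv z (r xy).
Proof.
move=> g'P.
pose Z := ((T * T) * I)%type.
pose m : probability Z R := (g' \x lambda)%E.
have mxx' : measurable_fun [set: Z] (fun z : Z => z.1) by exact: measurable_fst.
have mx : measurable_fun [set: Z] (fun z : Z => z.1.1).
  exact: (measurableT_comp measurable_fst mxx').
have mx' : measurable_fun [set: Z] (fun z : Z => z.1.2).
  exact: (measurableT_comp measurable_snd mxx').
have mxu : measurable_fun [set: Z] (fun z : Z => (z.1.1, z.2)).
  by apply: measurable_fun_pair => //; exact: measurable_snd.
have my : measurable_fun [set: Z] (fun z : Z => F (z.1.1, z.2)).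
  exact: (measurableT_comp mF mxu).
have mglue : measurable_fun [set: Z] (fun z : Z => (z.1.2, F (z.1.1, z.2))).
  exact: measurable_fun_pair.
have expmu (h : T -> R) : bounded_measurable h -> \int[g']_q h q.1 = \int[mu]_x h x.
  move=> bh; rewrite -(mean_law g' measurable_fst bh); apply: eq_mean => A mA.
  by have [] := g'P _ mA.
have expF (h : T * T -> R) : bounded_measurable h ->
    \int[m]_z h (z.1.1, F (z.1.1, z.2)) = \int[g0]_q h q.
  move=> bh.
  have bhF : bounded_measurable (fun xu : T * I => h (xu.1, F xu)).
    exact: (bm_comp measurable_graph bh).
  have bhZ := bm_comp mxu bhF.
  rewrite (bm_fubini _ _ bhZ).2 FP//=.
  have [bk _] := bm_fubini mu lambda bhF.
  exact: (expmu (fun x => \int[lambda]_u h (x, F (x, u)))).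
have bcost := bm_cost r_minimal.
have bB2 : bounded_measurable (fun q : T * T => enorm (b q) ^+ 2).
  rewrite (_ : (fun _ => _) = (fun q : T * T => torus_dist q.1 q.2 ^+ 2))//.
  by apply/funext => -[x y]; rewrite enorm_b.
have br2 : bounded_measurable (fun q : T * T => enorm (r q) ^+ 2).
  rewrite (_ : (fun _ => _) = (fun q : T * T => torus_dist q.1 q.2 ^+ 2))//.
  by apply/funext => -[x y]; rewrite (enorm_r r_minimal).
exists (law m mglue).
  move=> A mA.
  have mA2 : measurable (snd @^-1` A : set (T * T)).
    by rewrite -[X in measurable X]setTI; exact: measurable_snd.
  have [_ <-] := g'P _ mA; have [_ <-] := g0P mA; split.
    transitivity (m ((snd @^-1` A) `*` setT)).
      by rewrite lawE; congr (m _); apply/seteqP; split=> z //= [].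
    transitivity (g' (snd @^-1` A) * lambda [set: I])%E.
      exact: product_measure1E.
    have -> : lambda [set: I] = 1%E by exact: unit_lebesgue_setT.
    by rewrite mule1.
  apply: prob_eq_mean => //.
  rewrite mean_law; last exact: bm_indic.
  have bA : bounded_measurable (\1_(snd @^-1` A) : T * T -> R) by exact: bm_indic.
  by rewrite -(expF _ bA).
rewrite /transport_cost mean_law//.
pose bz (z : Z) := b (z.1.1, F (z.1.1, z.2)).
have mbz : measurable_fun [set: Z] bz.
  by apply: (measurableT_comp mb); exact: measurable_fun_pair.
have mrz : measurable_fun [set: Z] (fun z : Z => r z.1).
  exact: (measurableT_comp (measurable_r r_minimal) mxx').
have bdot : bounded_measurable (fun z : Z => dotv (bz z) (r z.1)).
  split; first exact: measurable_fun_dotv.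
  exists (torus_bound R d ^+ 2) => z.
  have B0 := @torus_bound_gt0 R d.
  have nb : enorm (bz z) ^+ 2 <= torus_bound R d ^+ 2.
    rewrite ler_sqr ?nnegrE ?enorm_ge0 ?(ltW B0)// enorm_b.
    exact: torus_norm_bound.
  have nr : enorm (r z.1) ^+ 2 <= torus_bound R d ^+ 2.
    by rewrite ler_sqr ?nnegrE ?enorm_ge0 ?(ltW B0)// (enorm_r_bound r_minimal).
  have := dotv_young (bz z) (r z.1) (@ltr01 R).
  by rewrite invr1 !mul1r !ler_norml => /andP[? ?]; apply/andP; split; lra.
have bb2 : bounded_measurable (fun z : Z => enorm (bz z) ^+ 2).
  by apply: (bm_comp _ bB2); exact: measurable_fun_pair.
have brz : bounded_measurable (fun z : Z => enorm (r z.1) ^+ 2).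
  exact: (bm_comp mxx' br2).
have b2dot : bounded_measurable (fun z : Z => 2 * dotv (bz z) (r z.1)).
  exact: bmZ.
apply: (@le_trans _ _ (\int[m]_z (enorm (bz z) ^+ 2 + 2 * dotv (bz z) (r z.1)
    + enorm (r z.1) ^+ 2))).
  apply: mean_le => [||[[x x'] u]]; last exact: sqr_dist_le.
    exact: (bm_comp mglue bcost).
  by apply: bmD => //; exact: bmD.
rewrite meanD//; last exact: bmD.
rewrite meanD// meanZ//.
rewrite (expF (fun q => enorm (b q) ^+ 2))// (bm_fubini _ _ brz).2 /=.
have -> : \int[g0]_q enorm (b q) ^+ 2 = \int[g0]_q (torus_dist q.1 q.2 ^+ 2).
  by apply: eq_Rintegral => -[x y] _; rewrite enorm_b.
have -> : \int[g']_xy \int[lambda]_u enorm (r xy) ^+ 2 =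
    \int[g']_q (torus_dist q.1 q.2 ^+ 2).
  by apply: eq_Rintegral => -[x y] _; rewrite mean_cst (enorm_r r_minimal).
have [bk ->] := bm_fubini g' lambda bdot.
have -> : \int[g']_xy \int[psi xy.1]_z dotv z (r xy) =
    \int[g']_xy (eps^-1 * \int[lambda]_u dotv (bz (xy, u)) (r xy)).
  apply: eq_Rintegral => xy _; rewrite -meanZ; last first.
    by apply: (bm_comp (measurable_pair1 _) bdot).
  rewrite (@mean_slope xy.1 _ ((torus_bound R d / eps) ^+ 2 + torus_bound R d ^+ 2)).
  - by apply: eq_Rintegral => u _; rewrite /slope dotvZl.
  - by apply: measurable_fun_dotv => //; exact: measurable_id.
  - move=> z zb; have B0 := @torus_bound_gt0 R d.
    have nr : enorm (r xy) ^+ 2 <= torus_bound R d ^+ 2.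
      by rewrite ler_sqr ?nnegrE ?enorm_ge0 ?(ltW B0)// (enorm_r_bound r_minimal).
    have nz : enorm z ^+ 2 <= (torus_bound R d / eps) ^+ 2.
      by rewrite ler_sqr ?nnegrE ?enorm_ge0// (le_trans _ zb)// enorm_ge0.
    have := sqr_ge0 (enorm z); have := sqr_ge0 (enorm (r xy)).
    have := dotv_young z (r xy) (@ltr01 R).
    by rewrite invr1 !mul1r !ler_norml => /andP[? ?] ? ?; apply/andP; split; lra.
rewrite meanZ// mulrA [2 * eps * _]mulfK ?gt_eqF//.
lra.
Qed.

End Superdifferential.
End Touching.

Section TouchingLemma.
Context {R : realType} {d : nat}.
Local Notation T := (torus R d).
Local Notation E := 'rV[R]_d.
Local Notation pi := (\pi_(torus R d)).
Variables (r : T * T -> E) (r_minimal : minimal_representative r).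

Lemma square_littleo (c : R) :
  (fun h : R => c * h ^+ 2) =o_ (nbhs (0 : R)) (fun h : R => h).
Proof.
apply/eqoP => e e0; have K0 : 0 < `|c| + 1 by rewrite ltr_wpDl.
have : nbhs (0 : R) [set h | `|h| < e / (`|c| + 1)].
  have e1 : 0 < e / (`|c| + 1) by rewrite divr_gt0.
  have := @nbhsx_ballx R R^o 0 _ e1; apply: filterS => h /=.
  by rewrite /ball /= sub0r normrN.
apply: filterS => h he; rewrite expr2 mulrA normrM ler_wpM2r// normrM.
apply: (@le_trans _ _ ((`|c| + 1) * `|h|)).
  by rewrite ler_wpM2r// lerDl.
by rewrite mulrC -ler_pdivlMr// ltW.
Qed.

(* The field [b] is a parameter rather than [r] because [r (x, y)] and
   [- r (y, x)] may differ on the cut locus, while the sub- and the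
   super-solution must be tested with the same momentum. *)
Lemma touching_superdiff (W : R -> prob R d -> R) (t theta eps : R)
    (mu nu : prob R d) (g0 : probability (T * T)%type R) (b : T * T -> E) :
  0 < eps -> measurable_fun [set: T * T] b ->
  (forall x y, pi (b (x, y)) = x - y) ->
  (forall x y, enorm (b (x, y)) = torus_dist x y) ->
  couplings mu nu g0 ->
  (forall s mu' g, 0 <= s <= t -> couplings mu' nu g ->
    W s mu' - (2 * eps)^-1 * transport_cost g <=
      W t mu - (2 * eps)^-1 * transport_cost g0 + theta * (s - t)
        + (2 * eps)^-1 * (s - t) ^+ 2) ->
  exists psi : T -> probability E R, [/\ superdiff r W t mu (theta, psi),
    forall x, exists (k : measurableTypeR R -> E) (mk : measurable_fun setT k),
      (forall u, enorm (k u) <= torus_bound R d / eps) /\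
      psi x = law (unit_lebesgue R) mk &
    forall (h : T * E -> R) (M : R), measurable_fun [set: T * E] h ->
      (forall x z, enorm z <= torus_bound R d / eps -> `|h (x, z)| <= M) ->
      \int[mu]_x \int[psi x]_z h (x, z) = \int[g0]_q h (q.1, eps^-1 *: b q)].
Proof.
move=> eps0 mb pi_b enorm_b g0P maxP.
have [|F [mF FP]] := torus_disintegration r_minimal (g := g0) (mu := mu).
  by move=> A mA; have [] := g0P _ mA.
exists (randomized_law (measurable_slope mb mF eps)); split; last 2 first.
(* The bounded random variable behind [psi x] is made explicit for the later reflection of laws. *)
- move=> x; exists (fun u => slope b F eps (x, u)).
  exists (measurable_randomized (measurable_slope mb mF eps) x); split=> // u.
  exact: enorm_slope.
- by move=> h M; exact: mean_slope_coupling.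
split.
- exact: measurable_randomized_law.
- exists (torus_bound R d / eps + 1).
    by rewrite ltr_wpDl// divr_ge0 ?ltW// torus_bound_gt0.
  by move=> x; exact: msupport_slope.
(* The quadratic errors in time and in the cost of the plan fit together under the square of
   [|s - t|] plus the root of the cost. *)
exists (fun h => (2 * eps)^-1 * h ^+ 2); first exact: square_littleo.
move=> s mu' g' st g'P.
have [g gP gcost] := glued_coupling r_minimal mb pi_b enorm_b mF eps0 g0P FP g'P.
have := maxP s mu' g st gP.
have e2 : 0 < (2 * eps)^-1 by rewrite invr_gt0 mulr_gt0.
have := ler_wpM2l (ltW e2) gcost.
set J := \int[g']_xy _; rewrite mulrDr mulrDr.
have -> : (2 * eps)^-1 * (2 * eps * J) = J by rewrite mulKf// gt_eqF// mulr_gt0.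
have sq : (s - t) ^+ 2 + transport_cost g' <=
    (`|s - t| + Num.sqrt (transport_cost g')) ^+ 2.
  rewrite [leRHS]sqrrD real_normK ?num_real// sqr_sqrtr ?transport_cost_ge0//.
  have : 0 <= `|s - t| * Num.sqrt (transport_cost g') by rewrite mulr_ge0 ?sqrtr_ge0.
  by rewrite mulr2n; lra.
have := ler_wpM2l (ltW e2) sq; rewrite mulrDr.
move: (_ * (_ + _) ^+ 2) (_ * (s - t) ^+ 2) (_ * transport_cost g).
move: (_ * transport_cost g0) (_ * transport_cost g') (theta * _) => *; lra.
Qed.

End TouchingLemma.

Section Maximum.
Context {R : realType} {d : nat}.
Local Notation T := (torus R d).
Local Notation E := 'rV[R]_d.
Variables (r : T * T -> E) (r_minimal : minimal_representative r).
Local Notation marginal1 g := (law g measurable_fst : prob R d).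
Local Notation marginal2 g := (law g measurable_snd : prob R d).

Lemma marginal1_cvg (J : Type) (G : set_system J) (FG : Filter G)
    (g : J -> probability (T * T)%type R) (Q : probability (T * T)%type R) :
  (forall h : T * T -> R, bounded_measurable h ->
    tail_continuous (h \o decode_pair) ->
    \int[g j]_q h q @[j --> G] --> \int[Q]_q h q) ->
  marginal1 (g j) @[j --> G] --> marginal1 Q.
Proof.
move=> gQ; apply: prob_cvg => h ch; have bh := bm_continuous r_minimal ch.
rewrite mean_law//; under eq_fun do rewrite mean_law//.
apply: (gQ (fun q => h q.1)); first exact: bm_comp measurable_fst bh.
move=> b e e0; have [n nP] := tail_continuous_decode ch (evens b) e0.
by exists n.*2 => b' /initial_evens_odds[/nP].
Qed.

Lemma marginal2_cvg (J : Type) (G : set_system J) (FG : Filter G)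
    (g : J -> probability (T * T)%type R) (Q : probability (T * T)%type R) :
  (forall h : T * T -> R, bounded_measurable h ->
    tail_continuous (h \o decode_pair) ->
    \int[g j]_q h q @[j --> G] --> \int[Q]_q h q) ->
  marginal2 (g j) @[j --> G] --> marginal2 Q.
Proof.
move=> gQ; apply: prob_cvg => h ch; have bh := bm_continuous r_minimal ch.
rewrite mean_law//; under eq_fun do rewrite mean_law//.
apply: (gQ (fun q => h q.2)); first exact: bm_comp measurable_snd bh.
move=> b e e0; have [n nP] := tail_continuous_decode ch (odds b) e0.
by exists n.*2 => b' /initial_evens_odds[_ /nP].
Qed.

End Maximum.

(** * Doubling of variables *)

Section Gap.
Context {R : realType} {d : nat}.
Local Notation T := (torus R d).
Local Notation E := 'rV[R]_d.
Local Notation marginal1 g := (law g measurable_fst : prob R d).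
Local Notation marginal2 g := (law g measurable_snd : prob R d).
Variables (r : T * T -> E) (r_minimal : minimal_representative r).

(** The cost converges, rather than being only semicontinuous, because the squared distance is
    itself a test function of [torus_coupling_compact]. *)
Lemma compact_limit (J : Type) (G : set_system J) (GU : UltraFilter G)
    (t s : J -> R) (g : J -> probability (T * T)%type R) (t1 : R) :
  (forall j, 0 <= t j <= t1) -> (forall j, 0 <= s j <= t1) ->
  exists t0 s0 Q, [/\ 0 <= t0 <= t1 /\ 0 <= s0 <= t1,
    t j @[j --> G] --> t0, s j @[j --> G] --> s0,
    marginal1 (g j) @[j --> G] --> marginal1 Q /\
    marginal2 (g j) @[j --> G] --> marginal2 Q &
    transport_cost (g j) @[j --> G] --> transport_cost Q].
Proof.
move=> tb sb.
have [t0 tt0] := ultra_bounded_cvg (G := G) tb.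
have [s0 ss0] := ultra_bounded_cvg (G := G) sb.
have [Q QP] := torus_coupling_compact r_minimal GU g.
have bnd (x : J -> R) x0 : (forall j, 0 <= x j <= t1) -> x j @[j --> G] --> x0 ->
    0 <= x0 <= t1.
  move=> xb xx0; apply/andP; split.
    by apply: (cvgr_to_ge xx0); apply: (@filterE _ G) => j; have /andP[] := xb j.
  by apply: (cvgr_to_le xx0); apply: (@filterE _ G) => j; have /andP[] := xb j.
exists t0, s0, Q; split=> //.
- by split; [exact: bnd tb tt0|exact: bnd sb ss0].
- by split; [exact: (marginal1_cvg r_minimal)|exact: (marginal2_cvg r_minimal)].
- by apply: QP; [exact: (bm_cost r_minimal)|exact: (tail_continuous_cost r_minimal)].
Qed.

Variables (U V : R -> prob R d -> R) (lam : R).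
Hypothesis uscU : usc (time_space (R := R) (d := d)) (fun q => U q.1 q.2).
Hypothesis uscV : usc (time_space (R := R) (d := d)) (fun q => - V q.1 q.2).

(** The term [lam * t] makes the sub-solution inequality strict by [lam]. *)
Definition gap (t s : R) (g : probability (T * T)%type R) : R :=
  U t (marginal1 g) - V s (marginal2 g) - lam * t.

Lemma gap_usc (J : Type) (G : set_system J) (FG : Filter G)
    (t s : J -> R) (g : J -> probability (T * T)%type R) (t0 s0 : R)
    (Q : probability (T * T)%type R) (a : R) :
  t j @[j --> G] --> t0 -> s j @[j --> G] --> s0 ->
  marginal1 (g j) @[j --> G] --> marginal1 Q ->
  marginal2 (g j) @[j --> G] --> marginal2 Q ->
  (forall j, 0 <= t j) -> (forall j, 0 <= s j) -> 0 <= t0 -> 0 <= s0 ->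
  gap t0 s0 Q < a -> G [set j | gap (t j) (s j) (g j) < a].
Proof.
move=> tt0 ss0 m1 m2 t_ge0 s_ge0 t0_ge0 s0_ge0 lt.
(* One third of the margin for each of the three terms of [gap]. *)
pose e := (a - gap t0 s0 Q) / 3.
have e0 : 0 < e by rewrite divr_gt0// subr_gt0.
have lte x : x < x + e by rewrite ltrDl.
have GU := usc_eventually FG uscU tt0 m1 (@filterE _ G FG _ t_ge0) t0_ge0 (lte _).
have GV := usc_eventually (U := fun t m => - V t m) FG uscV ss0 m2 (@filterE _ G FG _ s_ge0) s0_ge0 (lte _).
have Gl : G [set j | - (lam * t j) < - (lam * t0) + e].
  have : - (lam * t j) @[j --> G] --> - (lam * t0) by apply: cvgN; exact: cvgMr.
  by move/cvgr_lt; apply; rewrite ltrDl.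
apply: filterS (filterI GU (filterI GV Gl)) => j [/= ? [? ?]].
have : gap t0 s0 Q + 3 * e = a by rewrite /e mulrC divfK// addrC subrK.
by rewrite /gap; lra.
Qed.

Definition penalized (c t s : R) (g : probability (T * T)%type R) : R :=
  gap t s g - c * (transport_cost g + (t - s) ^+ 2).

Lemma penalized_max (c t1 : R) : 0 <= c -> 0 <= t1 ->
  exists t s g, [/\ 0 <= t <= t1, 0 <= s <= t1 &
    forall t' s' g', 0 <= t' <= t1 -> 0 <= s' <= t1 ->
      penalized c t' s' g' <= penalized c t s g].
Proof.
move=> c0 t10.
pose J := {y : R * R * probability (T * T)%type R | 0 <= y.1.1 <= t1 /\ 0 <= y.1.2 <= t1}.
pose Phi (j : J) := penalized c (sval j).1.1 (sval j).1.2 (sval j).2.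
(* An ultrafilter on the points themselves, containing all superlevel sets
   [Phi >= Phi z], converges to a maximum point. *)
pose F : set_system J := filter_from setT (fun z => [set y | Phi z <= Phi y]).
have j0 : J.
  by exists (0, 0, point); rewrite /= lexx.
have FF : ProperFilter F.
  apply: filter_from_proper; last by move=> z _; exists z => /=.
  apply: filter_from_filter; first by exists j0.
  move=> x y _ _; have [xy|/ltW yx] := leP (Phi x) (Phi y).
    by exists y => // z /= yz; split=> //; exact: le_trans yz.
  by exists x => // z /= xz; split=> //; exact: le_trans xz.
have [G [GU FG]] := ultraFilterLemma FF.
have [t0 [s0 [Q [[tb sb] tt0 ss0 [m1 m2] cQ]]]] := @compact_limit J G GU
  (fun j => (sval j).1.1) (fun j => (sval j).1.2) (fun j => (sval j).2) t1
  (fun j => (svalP j).1) (fun j => (svalP j).2).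
exists t0, s0, Q; split=> // t' s' g' t'b s'b.
rewrite leNgt; apply/negP => lt.
pose z : J := exist _ (t', s', g') (conj t'b s'b).
have Gz : G [set y | Phi z <= Phi y] by apply: FG; exists z.
(* Half of the supposed excess: near the limit, [gap] rises and the penalty falls by less than [e]
   each. *)
pose e := (penalized c t' s' g' - penalized c t0 s0 Q) / 2.
have e0 : 0 < e by rewrite divr_gt0// subr_gt0.
have Gg : G [set j | gap (sval j).1.1 (sval j).1.2 (sval j).2 < gap t0 s0 Q + e].
  apply: (gap_usc _ tt0 ss0 m1 m2).
  - by move=> j; have [/andP[]] := svalP j.
  - by move=> j; have [_ /andP[]] := svalP j.
  - by case/andP: tb.
  - by case/andP: sb.
  - by rewrite ltrDl.
have Gc : G [set j | c * (transport_cost Q + (t0 - s0) ^+ 2) - e <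
    c * (transport_cost (sval j).2 + ((sval j).1.1 - (sval j).1.2) ^+ 2)].
  have cc : c * (transport_cost (sval j).2 + ((sval j).1.1 - (sval j).1.2) ^+ 2) @[j --> G]
      --> c * (transport_cost Q + (t0 - s0) ^+ 2).
    apply: cvgMr; apply: cvgD => //.
    exact: (cvgM (cvgB tt0 ss0) (cvgB tt0 ss0)).
  by move/cvgr_gt : cc; apply; rewrite ltrBlDr ltrDl.
have [j [/= hz [hg hc]]] := filter_ex (filterI Gz (filterI Gg Gc)).
have : penalized c t' s' g' = penalized c t0 s0 Q + 2 * e.
  by rewrite /e mulrC divfK// addrC subrK.
move: hz; rewrite /Phi /z /= => hz.
rewrite {1}/penalized in hz.
by move: hz hg hc; rewrite /penalized; lra.
Qed.

End Gap.

(** * Vanishing of the penalty at the maxima *)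

Section VanishingPenalty.
Context {R : realType} {d : nat}.
Local Notation T := (torus R d).
Local Notation E := 'rV[R]_d.
Local Notation marginal1 g := (law g measurable_fst : prob R d).
Local Notation marginal2 g := (law g measurable_snd : prob R d).
Variables (r : T * T -> E) (r_minimal : minimal_representative r).
Variables (U V : R -> prob R d -> R) (lam : R).
Hypothesis uscU : usc (time_space (R := R) (d := d)) (fun q => U q.1 q.2).
Hypothesis uscV : usc (time_space (R := R) (d := d)) (fun q => - V q.1 q.2).

Lemma uscV_eq_prob t (mu nu : prob R d) : 0 <= t ->
  (forall A : set T, measurable A -> mu A = nu A) -> V t mu = V t nu.
Proof.
move=> t0 mn; apply: oppr_inj.
exact: (usc_eq_prob (U := fun t m => - V t m) uscV).
Qed.

Lemma measurable_diagonal : measurable_fun [set: T] (fun x : T => (x, x)).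
Proof. by apply: measurable_fun_pair; exact: measurable_id. Qed.

Definition diagonal_coupling (mu : prob R d) : probability (T * T)%type R :=
  law mu measurable_diagonal.

Lemma diagonal_cost mu : transport_cost (diagonal_coupling mu) = 0.
Proof.
rewrite /transport_cost mean_law; last exact: (bm_cost r_minimal).
under eq_Rintegral => x _.
  rewrite /= /torus_dist subrr.
  have -> : torus_norm (0 : T) = 0.
    apply/eqP; rewrite eq_le (torus_norm_ge0 r_minimal) andbT.
    rewrite -(raddf0 \pi_(torus R d)); apply: le_trans (torus_norm_le _) _.
    by rewrite /enorm /dotv big1 ?sqrtr0// => i _; rewrite mxE mul0r.
  rewrite expr0n /=.
over.
exact: mean_cst.
Qed.

Lemma diagonal_gap (t : R) (mu : prob R d) : 0 <= t ->
  gap U V lam t t (diagonal_coupling mu) = U t mu - V t mu - lam * t.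
Proof.
move=> t0; rewrite /gap; congr (_ - _ - _).
  exact: (usc_eq_prob uscU).
exact: uscV_eq_prob.
Qed.

(** Take maximisers for [eps = 1 / (n + 1)]. Comparison with the diagonal coupling of [mu1] bounds
    the penalty, so the limit has zero cost and equal times; comparison with the diagonal at the
    limit makes the penalty small. *)
Lemma vanishing_penalty (t1 eta : R) (mu1 : prob R d) :
  0 <= t1 -> 0 < eta -> 0 < U t1 mu1 - V t1 mu1 - lam * t1 ->
  (forall mu, U 0 mu <= V 0 mu) ->
  exists eps t s g, [/\ 0 < eps <= 1, 0 < t <= t1, 0 < s <= t1,
    forall t' s' g', 0 <= t' <= t1 -> 0 <= s' <= t1 ->
      penalized U V lam (2 * eps)^-1 t' s' g' <= penalized U V lam (2 * eps)^-1 t s g &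
    (2 * eps)^-1 * (transport_cost g + (t - s) ^+ 2) < eta].
Proof.
move=> t10 eta0 m0 UV0; set m := _ - _ - _ in m0.
pose c n : R := (2 * n.+1%:R^-1)^-1.
have c0 n : 0 < c n by rewrite invr_gt0 mulr_gt0.
have cE n : c n = n.+1%:R / 2 by rewrite /c invfM invrK mulrC.
have /choice[y yP] n : exists y : R * R * probability (T * T)%type R,
    [/\ 0 <= y.1.1 <= t1, 0 <= y.1.2 <= t1 &
    forall t' s' g', 0 <= t' <= t1 -> 0 <= s' <= t1 ->
      penalized U V lam (c n) t' s' g' <= penalized U V lam (c n) y.1.1 y.1.2 y.2].
  have [t [s [g gP]]] := penalized_max r_minimal lam uscU uscV (ltW (c0 n)) t10.
  by exists (t, s, g).
pose t n := (y n).1.1; pose s n := (y n).1.2; pose g n := (y n).2.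
have tb n : 0 <= t n <= t1 by have [] := yP n.
have sb n : 0 <= s n <= t1 by have [] := yP n.
have yM n : forall t' s' g', 0 <= t' <= t1 -> 0 <= s' <= t1 ->
    penalized U V lam (c n) t' s' g' <= penalized U V lam (c n) (t n) (s n) (g n).
  by have [] := yP n.
pose S n := transport_cost (g n) + (t n - s n) ^+ 2.
have S0 n : 0 <= S n by rewrite addr_ge0 ?sqr_ge0 ?transport_cost_ge0.
(* The maximum for the penalty constant 0 bounds [gap] from above. *)
have [K KP] : exists K, forall n, gap U V lam (t n) (s n) (g n) <= K.
  have [t' [s' [g' [_ _ gM]]]] := penalized_max r_minimal lam uscU uscV (lexx 0) t10.
  exists (penalized U V lam 0 t' s' g') => n.
  by have := gM _ _ (g n) (tb n) (sb n); rewrite {1}/penalized mul0r subr0.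
have mM n : m <= gap U V lam (t n) (s n) (g n) - c n * S n.
  have t11 : 0 <= t1 <= t1 by rewrite t10 lexx.
  have := yM n t1 t1 (diagonal_coupling mu1) t11 t11.
  by rewrite {1}/penalized diagonal_gap// diagonal_cost subrr expr0n /= addr0 mulr0 subr0.
have [G [GU ooG]] := ultraFilterLemma (@eventually_filter).
have [t0 [s0 [Q [[t0b s0b] tt0 ss0 [m1 m2] cQ]]]] :=
  compact_limit r_minimal GU g tb sb.
have SL : S n @[n --> G] --> transport_cost Q + (t0 - s0) ^+ 2.
  by apply: cvgD => //; exact: (cvgM (cvgB tt0 ss0) (cvgB tt0 ss0)).
have Sle n : S n <= 2 * (K - m) * n.+1%:R^-1.
  rewrite ler_pdivlMr//; have := KP n; have := mM n; rewrite cE.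
  rewrite (_ : n.+1%:R / 2 * S n = S n * n.+1%:R / 2); last by ring.
  by move: (S n * _) => X; lra.
have L0 : transport_cost Q + (t0 - s0) ^+ 2 = 0.
  apply/eqP; rewrite eq_le addr_ge0 ?sqr_ge0 ?transport_cost_ge0// andbT.
  have inv0 : 2 * (K - m) * n.+1%:R^-1 @[n --> G] --> 2 * (K - m) * 0.
    by apply: cvgMr; apply: cvg_trans (cvg_harmonic); exact: cvg_app.
  rewrite mulr0 in inv0.
  by apply: (ler_cvg_to SL inv0); exact: filterE.
move: L0 => /eqP; rewrite paddr_eq0 ?sqr_ge0 ?transport_cost_ge0// => /andP[/eqP Q0].
rewrite sqrf_eq0 subr_eq0 => /eqP ts0; rewrite -ts0 in ss0 s0b.
have t0_ge0 : 0 <= t0 by case/andP: t0b.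
pose mu := marginal1 Q.
(* At zero cost both marginals of [Q] integrate continuous functions alike, and [V] cannot tell them
   apart. *)
have gapE : gap U V lam t0 t0 Q = U t0 mu - V t0 mu - lam * t0.
  rewrite /gap; congr (_ - _ - _); apply: oppr_inj.
  apply: (usc_indiscernible (U := fun t m => - V t m) uscV) => // h ch.
  have bh := bm_continuous r_minimal ch.
  rewrite !mean_law//; apply/esym; apply: (cost_eq0 r_minimal) => //.
  by case: bh.
(* The penalty is thus at most the excess of [gap] over its value at the limit, which semicontinuity
   makes small. *)
have Mle n : gap U V lam t0 t0 Q <= gap U V lam (t n) (s n) (g n) - c n * S n.
  have := yM n t0 t0 (diagonal_coupling mu) t0b t0b.
  by rewrite {1}/penalized diagonal_gap// diagonal_cost subrr expr0n /= addr0 mulr0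
    subr0 -gapE.
have near_gap e : 0 < e -> G [set n | gap U V lam (t n) (s n) (g n) < gap U V lam t0 t0 Q + e].
  move=> e0; apply: (gap_usc uscU uscV _ tt0 ss0 m1 m2) => //.
  - by move=> n; have /andP[] := tb n.
  - by move=> n; have /andP[] := sb n.
  - by rewrite ltrDl.
have gap_gt0 : m <= gap U V lam t0 t0 Q.
  apply/ler_addgt0Pr => e e0; have [n /= ?] := filter_ex (near_gap e e0).
  have := mM n; have := mulr_ge0 (ltW (c0 n)) (S0 n); lra.
(* At time 0 the initial ordering would make the limit gap nonpositive, whereas it is at least
   [m]. *)
have t0_gt0 : 0 < t0.
  rewrite lt_neqAle t0_ge0 andbT; apply/negP => /eqP t00.
  move: gap_gt0; rewrite gapE -t00 mulr0 subr0; have := UV0 mu; lra.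
have Gt : G [set n | 0 < t n] by move/cvgr_gt : (tt0) => /(_ 0 t0_gt0).
have Gs : G [set n | 0 < s n] by move/cvgr_gt : (ss0) => /(_ 0 t0_gt0).
have [n [/= tn [sn gn]]] := filter_ex (filterI Gt (filterI Gs (near_gap eta eta0))).
exists n.+1%:R^-1, (t n), (s n), (g n); split.
- by rewrite invr_gt0 ltr0Sn invf_le1 ?ler1n.
- by rewrite tn; case/andP: (tb n).
- by rewrite sn; case/andP: (sb n).
- exact: yM.
- by have := Mle n; rewrite -/(S n) -/(c n); lra.
Qed.

End VanishingPenalty.

(** * Measurability and boundedness of the Hamiltonian *)

Section Hamiltonian.
Context {R : realType} {d : nat}.
Local Notation T := (torus R d).
Local Notation E := 'rV[R]_d.
Local Notation marginal1 g := (law g measurable_fst : prob R d).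
Local Notation marginal2 g := (law g measurable_snd : prob R d).
Variables (r : T * T -> E) (r_minimal : minimal_representative r).
Variables (H : R -> T -> prob R d -> E -> R) (C : R).
Hypothesis H_continuous :
  {within [set q : R * T * prob R d * E | 0 <= q.1.1.1],
    continuous (fun q => H q.1.1.1 q.1.1.2 q.1.2 q.2)}.
Hypothesis C0 : 0 < C.
Hypothesis H_lipschitz :
  forall (p : E) (s t : R) (mu nu : prob R d) (x y : T), 0 <= s -> 0 <= t ->
    `|H t x mu p - H s y nu p| <=
      C * (1 + enorm p) * (`|t - s| + W2 mu nu + torus_dist x y).

Lemma H_continuous_section (t : R) (mu : prob R d) : 0 <= t ->
  continuous (fun q : T * E => H t q.1 mu q.2).
Proof.
move=> t0 [x z].
have /subspace_continuousP /(_ (t, x, mu, z) t0) Hc := H_continuous.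
pose f (q : T * E) := (t, q.1, mu, q.2).
have c1 : (t, q.1) @[q --> nbhs (x, z)] --> (t, x).
  exact: (cvg_pair (cvg_cst _) cvg_fst).
have c2 : (t, q.1, mu) @[q --> nbhs (x, z)] --> (t, x, mu).
  exact: (cvg_pair c1 (cvg_cst _)).
have cf : f q @[q --> nbhs (x, z)] --> (t, x, mu, z).
  exact: (cvg_pair c2 cvg_snd).
move=> A HA.
have HB : nbhs (t, x, mu, z) [set q : R * T * prob R d * E |
    0 <= q.1.1.1 -> A (H q.1.1.1 q.1.1.2 q.1.2 q.2)] := Hc A HA.
have fB : nbhs (x, z) [set q : T * E | 0 <= t -> A (H t q.1 mu q.2)] := cf _ HB.
suff : nbhs (x, z) [set q : T * E | A (H t q.1 mu q.2)] by [].
by apply: filterS fB => q /(_ t0).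
Qed.

Lemma measurable_H (t : R) (mu : prob R d) : 0 <= t ->
  measurable_fun [set: T * E] (fun q : T * E => H t q.1 mu q.2).
Proof.
by move=> t0; apply: (measurable_continuous_prod r_minimal); exact: H_continuous_section.
Qed.

(** Bounded momenta lie in a compact box, which bounds [H] at the point 0 of the torus; the
    Lipschitz condition transports the bound to every [x]. *)
Lemma H_bounded (t : R) (mu : prob R d) (K : R) : 0 <= t ->
  exists M, forall x z, enorm z <= K -> `|H t x mu z| <= M.
Proof.
move=> t0.
have cH0 : continuous (fun z : E => H t 0 mu z).
  move=> z.
  have c0 : ((0 : T), y) @[y --> nbhs z] --> ((0 : T), z).
    exact: (cvg_pair (cvg_cst _) cvg_id).
  move=> A HA; have HB := @H_continuous_section t mu t0 (0, z) A HA.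
  by have := c0 _ HB.
pose box := [set z : E | forall i, `[- K, K]%classic (z 0 i)].
have cbox : compact box.
  exact: (@rV_compact R d (fun=> `[- K, K]%classic) (fun=> @segment_compact R _ _)).
have := continuous_compact (continuous_subspaceT cH0) cbox.
move=> /compact_bounded[M [_ MP]].
exists (`|M + 1| + C * (1 + K) * (W2 mu mu + torus_bound R d)) => x z zK.
have z0 : `|H t 0 mu z| <= `|M + 1|.
  apply: le_trans (ler_norm _); apply: (MP (M + 1)); first by rewrite ltrDl.
  exists z => // i; rewrite /= in_itv /= -ler_norml.
  exact: le_trans (coord_le_enorm z i) zK.
rewrite -[H t x mu z](subrK (H t 0 mu z)) addrC.
apply: le_trans (ler_normD _ _) (lerD z0 _).
apply: le_trans (H_lipschitz z mu mu x 0 t0 t0) _.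
rewrite subrr normr0 add0r; apply: ler_pM.
- by rewrite mulr_ge0 ?addr_ge0 ?enorm_ge0// ltW.
- by rewrite addr_ge0 ?W2_ge0 ?(torus_dist_ge0 r_minimal).
- by rewrite ler_pM2l// lerD2l.
- by rewrite lerD2l; exact: torus_norm_bound.
Qed.

End Hamiltonian.

(** * The two viscosity inequalities at a maximum *)

Section Comparison.
Context {R : realType} {d : nat}.
Local Notation T := (torus R d).
Local Notation E := 'rV[R]_d.
Local Notation marginal1 g := (law g measurable_fst : prob R d).
Local Notation marginal2 g := (law g measurable_snd : prob R d).
Variables (r : T * T -> E) (r_minimal : minimal_representative r).
Variables (H : R -> T -> prob R d -> E -> R) (C : R).
Hypothesis H_continuous :
  {within [set q : R * T * prob R d * E | 0 <= q.1.1.1],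
    continuous (fun q => H q.1.1.1 q.1.1.2 q.1.2 q.2)}.
Hypothesis C0 : 0 < C.
Hypothesis H_lipschitz :
  forall (p : E) (s t : R) (mu nu : prob R d) (x y : T), 0 <= s -> 0 <= t ->
    `|H t x mu p - H s y nu p| <=
      C * (1 + enorm p) * (`|t - s| + W2 mu nu + torus_dist x y).
Variables (U V : R -> prob R d -> R) (lam : R).
Hypothesis U_subsolution : viscosity_subsolution r H U.
Hypothesis V_supersolution : viscosity_supersolution r H V.

(** Both sides are the Lebesgue integral of [h (- k u)]; boundedness is asked only along [k], since
    [H] is unbounded in the momentum. *)
Lemma mean_reflected_law (k : measurableTypeR R -> E) (mk : measurable_fun setT k)
    (h : E -> R) (M : R) : measurable_fun [set: E] h -> (forall u, `|h (- k u)| <= M) ->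
  \int[reflected_law (law (unit_lebesgue R) mk)]_z h z =
  \int[law (unit_lebesgue R) mk]_z h (- z).
Proof.
move=> mh hM.
have mo := @measurable_oppv R d.
have mok := measurableT_comp mo mk.
have mho := measurableT_comp mh mo.
have bhk : bounded_measurable (fun u => h (- k u)).
  by split; [exact: (measurableT_comp mho mk)|exists M].
rewrite (mean_law_comp (unit_lebesgue R) mk mho bhk).
rewrite -(mean_law_comp (unit_lebesgue R) mok mh bhk).
exact: eq_mean.
Qed.

Lemma lsc_usc_oppr : usc (time_space (R := R) (d := d)) (fun q => - V q.1 q.2).
Proof.
rewrite /usc; under [X in lower_semicontinuous X]eq_fun do rewrite opprK.
exact: V_supersolution.1.
Qed.

Let uscU := U_subsolution.1.
Let uscV := lsc_usc_oppr.

Lemma measurable_swap : measurable_fun [set: T * T] (fun q : T * T => (q.2, q.1)).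
Proof.
by apply: measurable_fun_pair; [exact: measurable_snd|exact: measurable_fst].
Qed.

Lemma couplings_swap (mu nu : prob R d) (g : probability (T * T)%type R) :
  couplings mu nu g -> couplings nu mu (law g measurable_swap).
Proof. by move=> gP A mA; have [? ?] := gP A mA; split. Qed.

Lemma transport_cost_swap (g : probability (T * T)%type R) :
  transport_cost (law g measurable_swap) = transport_cost g.
Proof.
rewrite /transport_cost mean_law; last exact: (bm_cost r_minimal).
apply: eq_Rintegral => -[x y] _; congr (_ ^+ 2).
by rewrite /torus_dist -(torus_normN r_minimal) opprB.
Qed.

Lemma marginals_coupling (g : probability (T * T)%type R) :
  couplings (marginal1 g) (marginal2 g) g.
Proof. by []. Qed.

Variables (eps t s t1 : R) (g : probability (T * T)%type R).
Hypothesis eps0 : 0 < eps.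
Hypothesis t0 : 0 < t <= t1.
Hypothesis s0 : 0 < s <= t1.
Hypothesis maximum : forall t' s' g', 0 <= t' <= t1 -> 0 <= s' <= t1 ->
  penalized U V lam (2 * eps)^-1 t' s' g' <= penalized U V lam (2 * eps)^-1 t s g.
Local Notation mu := (marginal1 g).
Local Notation nu := (marginal2 g).
Local Notation momentum q := (eps^-1 *: - r q).

Lemma enorm_momentum q : enorm (momentum q) = torus_dist q.1 q.2 / eps.
Proof.
case: q => x y; rewrite enormZ ger0_norm ?invr_ge0 ?(ltW eps0)// enormN.
by rewrite (enorm_r r_minimal) mulrC.
Qed.

Lemma enorm_momentum_le q : enorm (momentum q) <= torus_bound R d / eps.
Proof.
rewrite enorm_momentum ler_pM2r ?invr_gt0//; exact: torus_norm_bound.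
Qed.

Lemma measurable_momentum : measurable_fun [set: T * T] (fun q => momentum q).
Proof.
have mr := measurableT_comp (@measurable_oppv R d) (measurable_r r_minimal).
exact: (measurableT_comp (@measurable_scalev R d eps^-1) mr).
Qed.

Lemma bm_H1 : bounded_measurable (fun q : T * T => H t q.1 mu (momentum q)).
Proof.
have t_ge0 : 0 <= t by case/andP: t0 => /ltW.
have [M MP] := H_bounded r_minimal H_continuous C0 H_lipschitz mu
  (torus_bound R d / eps) t_ge0.
split; last by exists M => q; apply: MP; exact: enorm_momentum_le.
have mq := measurable_fun_pair (measurable_fst : measurable_fun [set: T * T] _)
  measurable_momentum.
exact: (measurableT_comp (measurable_H r_minimal H_continuous mu t_ge0) mq).
Qed.

Lemma bm_H2 : bounded_measurable (fun q : T * T => H s q.2 nu (momentum q)).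
Proof.
have s_ge0 : 0 <= s by case/andP: s0 => /ltW.
have [M MP] := H_bounded r_minimal H_continuous C0 H_lipschitz nu
  (torus_bound R d / eps) s_ge0.
split; last by exists M => q; apply: MP; exact: enorm_momentum_le.
have mq := measurable_fun_pair (measurable_snd : measurable_fun [set: T * T] _)
  measurable_momentum.
exact: (measurableT_comp (measurable_H r_minimal H_continuous nu s_ge0) mq).
Qed.

(** Freeze [s] and [nu]. The time slope is the derivative of [lam * t + (t - s) ^+ 2 / (2 * eps)],
    and the field is [b = - r]. *)
Lemma subsolution_inequality :
  lam + (t - s) / eps + \int[g]_q H t q.1 mu (momentum q) <= 0.
Proof.
have [/andP[t_gt0 tt1] /andP[s_gt0 st1]] := (t0, s0).
have t_ge0 := ltW t_gt0.
have mb := measurableT_comp (@measurable_oppv R d) (measurable_r r_minimal).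
have pib (x y : T) : \pi_(torus R d) (- r (x, y)) = x - y.
  by rewrite pi_opp (pi_r r_minimal) opprB.
have nb (x y : T) : enorm (- r (x, y)) = torus_dist x y.
  by rewrite enormN (enorm_r r_minimal).
have touch t' mu' g' : 0 <= t' <= t -> couplings mu' nu g' ->
    U t' mu' - (2 * eps)^-1 * transport_cost g' <=
    U t mu - (2 * eps)^-1 * transport_cost g + (lam + (t - s) / eps) * (t' - t)
      + (2 * eps)^-1 * (t' - t) ^+ 2.
  move=> /andP[t'0 t't] g'P.
  have t'b : 0 <= t' <= t1 by rewrite t'0 (le_trans t't).
  have sb : 0 <= s <= t1 by rewrite (ltW s_gt0).
  have := maximum g' t'b sb; rewrite /penalized /gap.
  have -> : U t' mu' = U t' (marginal1 g').
    by apply: usc_eq_prob => // A mA; have [<-] := g'P A mA.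
  have -> : V s (marginal2 g') = V s nu.
    by apply: (uscV_eq_prob uscV) => [|A mA]; [exact: ltW|have [_ <-] := g'P A mA].
  (* With [c] for [(2 * eps)^-1], what remains is the expansion of [(t' - s) ^+ 2] around [t]. *)
  have -> : (t - s) / eps = (2 * eps)^-1 * (2 * (t - s)).
    by field; rewrite gt_eqF.
  move: (2 * eps)^-1 => c.
  move: (U _ _) (U _ _) (V _ _) (transport_cost _) (transport_cost _).
  by move=> *; lra.
have [psi [psiP _ psiE]] :=
  touching_superdiff r_minimal eps0 mb pib nb (@marginals_coupling g) touch.
have [M MP] := H_bounded r_minimal H_continuous C0 H_lipschitz mu
  (torus_bound R d / eps) t_ge0.
have mH := measurable_H r_minimal H_continuous mu t_ge0.
have := psiE (fun q => H t q.1 mu q.2) M mH (fun x z => MP x z).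
by move=> <-; exact: U_subsolution.2 psiP.
Qed.

(** Freeze [t] and [mu]; then [- V] is touched from the second point of the coupling, hence the
    swap. Its field is [r] with arguments exchanged, and the reflection in [subdiff] turns this into
    the momentum of the sub-solution. *)
Lemma supersolution_inequality :
  0 <= (t - s) / eps + \int[g]_q H s q.2 nu (momentum q).
Proof.
have [/andP[t_gt0 tt1] /andP[s_gt0 st1]] := (t0, s0).
have s_ge0 := ltW s_gt0.
have mb := measurableT_comp (measurable_r r_minimal) measurable_swap.
have pib (y x : T) : \pi_(torus R d) ((r \o (fun q : T * T => (q.2, q.1))) (y, x)) = y - x.
  exact: (pi_r r_minimal).
have nb (y x : T) : enorm ((r \o (fun q : T * T => (q.2, q.1))) (y, x)) = torus_dist y x.
  by rewrite /= (enorm_r r_minimal) /torus_dist -(torus_normN r_minimal) opprB.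
have touch s' nu' g' : 0 <= s' <= s -> couplings nu' mu g' ->
    - V s' nu' - (2 * eps)^-1 * transport_cost g' <=
    - V s nu - (2 * eps)^-1 * transport_cost (law g measurable_swap)
      + - ((t - s) / eps) * (s' - s) + (2 * eps)^-1 * (s' - s) ^+ 2.
  move=> /andP[s'0 s's] g'P.
  have s'b : 0 <= s' <= t1 by rewrite s'0 (le_trans s's).
  have tb : 0 <= t <= t1 by rewrite (ltW t_gt0).
  have := maximum (law g' measurable_swap) tb s'b.
  rewrite /penalized /gap !transport_cost_swap.
  have -> : V s' nu' = V s' (marginal2 (law g' measurable_swap)).
    by apply: (uscV_eq_prob uscV) => // A mA; have [<-] := g'P A mA.
  have -> : U t (marginal1 (law g' measurable_swap)) = U t mu.
    by apply: usc_eq_prob => [//||A mA]; [exact: ltW|have [_ <-] := g'P A mA].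
  have -> : (t - s) / eps = (2 * eps)^-1 * (2 * (t - s)).
    by field; rewrite gt_eqF.
  move: (2 * eps)^-1 => c.
  move: (V _ _) (V _ _) (U _ _) (transport_cost _) (transport_cost _).
  by move=> *; lra.
have [psi [psiP psiL psiE]] := touching_superdiff (W := fun s' m => - V s' m) r_minimal eps0
  mb pib nb (couplings_swap (@marginals_coupling g)) touch.
have [M MP] := H_bounded r_minimal H_continuous C0 H_lipschitz nu
  (torus_bound R d / eps) s_ge0.
have mH := measurable_H r_minimal H_continuous nu s_ge0.
have mHN : measurable_fun [set: T * E] (fun q : T * E => H s q.1 nu (- q.2)).
  have mq := measurable_fun_pair (measurable_fst : measurable_fun [set: T * E] _)
    (measurableT_comp (@measurable_oppv R d) measurable_snd).
  exact: (measurableT_comp mH mq).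
have MN x z : enorm z <= torus_bound R d / eps -> `|H s x nu (- z)| <= M.
  by move=> zb; apply: MP; rewrite enormN.
have := psiE (fun q => H s q.1 nu (- q.2)) M mHN MN.
have -> : \int[law g measurable_swap]_q H s q.1 nu (- (eps^-1 *: r (q.2, q.1))) =
    \int[g]_q H s q.2 nu (momentum q).
  have bh := bm_comp measurable_swap bm_H2.
  rewrite -[RHS](_ : \int[law g measurable_swap]_q H s q.1 nu (momentum (q.2, q.1)) = _).
    by apply: eq_Rintegral => q _; rewrite scalerN.
  rewrite (mean_law g measurable_swap bh).
  by apply: eq_Rintegral => -[x y] _.
move=> <-.
have refl : Hbar H s nu (fun x => reflected_law (psi x)) =
    \int[nu]_x \int[psi x]_z H s x nu (- z).
  apply: eq_Rintegral => x _.
  have mHx : measurable_fun [set: E] (fun z => H s x nu z).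
    have mp : measurable_fun [set: E] (fun z : E => (x, z)) by exact: measurable_pair1.
    exact: (measurableT_comp mH mp).
  have [k [mk [kb ->]]] := psiL x.
  exact: (mean_reflected_law mk mHx (fun u => MN x _ (kb u))).
rewrite -refl; apply: V_supersolution.2 => //.
by exists (- ((t - s) / eps), psi) => //=; rewrite opprK.
Qed.

(** Subtracting the two inequalities bounds [lam] by the mean of a difference of Hamiltonians at one
    momentum, of length [torus_dist / eps]. Young's inequality with the free weight [k] handles the
    linear terms, that with weight [eps^-1] the products. *)
Lemma maximum_estimate (k : R) : 0 < k ->
  lam <= C * (3 / 2 * k + k^-1 * (transport_cost g + (t - s) ^+ 2)
              + 5 / 2 * (eps^-1 * (transport_cost g + (t - s) ^+ 2))).
Proof.
move=> k0.
have t_ge0 : 0 <= t by case/andP: t0 => /ltW.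
have s_ge0 : 0 <= s by case/andP: s0 => /ltW.
have k'0 : 0 < k^-1 by rewrite invr_gt0.
have e'0 : 0 < eps^-1 by rewrite invr_gt0.
have kk' : k^-1 * k = 1 by rewrite mulVf// gt_eqF.
have young (x : R) : x <= k / 2 + k^-1 / 2 * x ^+ 2.
  have := mulr_ge0 (ltW k'0) (sqr_ge0 (x - k)).
  have -> : k^-1 * (x - k) ^+ 2 = k^-1 * x ^+ 2 - 2 * (k^-1 * k) * x + k^-1 * k * k.
    by ring.
  by rewrite kk'; lra.
have WE := sqr_W2_le (@marginals_coupling g).
have bcost := bm_cost r_minimal.
(* [A] gathers what is constant in [q], and [B] the coefficient of the squared distance: [k^-1 / 2]
   from the linear terms, [2 * eps^-1] from the products. *)
have [A AE] : exists A, A = 3 / 2 * k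
    + (k^-1 + eps^-1) / 2 * ((t - s) ^+ 2 + W2 mu nu ^+ 2) by eexists.
have [B BE] : exists B, B = k^-1 / 2 + 2 * eps^-1 by eexists.
have pointwise q : H s q.2 nu (momentum q) - H t q.1 mu (momentum q) <=
    C * (A + B * torus_dist q.1 q.2 ^+ 2).
  have := H_lipschitz (momentum q) mu nu q.1 q.2 s_ge0 t_ge0.
  rewrite enorm_momentum ler_norml => /andP[le _].
  apply: (@le_trans _ _ (C * ((1 + torus_dist q.1 q.2 / eps) *
    (`|t - s| + W2 mu nu + torus_dist q.1 q.2)))).
    by rewrite mulrA -[leRHS]opprK lerNr opprB.
  rewrite ler_pM2l// AE BE -(real_normK (num_real (t - s))).
  move: (torus_dist q.1 q.2) (W2 mu nu) `|t - s| => rho W tau.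
  have yr := young rho; have yW := young W; have yt := young tau.
  have h1 := mulr_ge0 (ltW e'0) (sqr_ge0 (rho - tau)).
  have h2 := mulr_ge0 (ltW e'0) (sqr_ge0 (rho - W)).
  by move: yr yW yt h1 h2; move: k^-1 eps^-1 => k' e'; lra.
have integrated : lam <= C * (A + B * transport_cost g).
  have sub := subsolution_inequality; have sup := supersolution_inequality.
  apply: (@le_trans _ _ (\int[g]_q (H s q.2 nu (momentum q) - H t q.1 mu (momentum q)))).
    by rewrite (meanB g bm_H2 bm_H1); lra.
  have bB : bounded_measurable (fun q : T * T => B * torus_dist q.1 q.2 ^+ 2).
    exact: bmZ.
  have bAB : bounded_measurable (fun q : T * T => A + B * torus_dist q.1 q.2 ^+ 2).
    by apply: bmD => //; exact: bm_cst.
  apply: le_trans (mean_le g (bmB bm_H2 bm_H1) (bmZ C bAB) pointwise) _.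
  by rewrite (meanZ g C bAB) (meanD g (bm_cst _ A) bB) mean_cst (meanZ g B bcost).
(* Bounding the square of [W2] by the cost adds [1 / 2] to the coefficient 2 of [eps^-1], whence
   [5 / 2]. *)
apply: le_trans integrated _; rewrite ler_pM2l// AE BE.
have cost0 := transport_cost_ge0 g; have sq0 := sqr_ge0 (t - s).
have h1 := ler_wpM2l (ltW k'0) WE.
have h2 := ler_wpM2l (ltW e'0) WE.
have h3 := mulr_ge0 (ltW k'0) sq0; have h4 := mulr_ge0 (ltW e'0) sq0.
move: h1 h2 h3 h4; move: k^-1 eps^-1 (transport_cost g) (W2 mu nu ^+ 2) ((t - s) ^+ 2).
by move=> k' e' c w x *; lra.
Qed.

End Comparison.

Theorem theorem2p11 (R : realType) (d : nat)
    (r : torus R d * torus R d -> 'rV[R]_d)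
    (r_minimal : minimal_representative r)
    (H : R -> torus R d -> prob R d -> 'rV[R]_d -> R)
    (H_continuous :
      {within [set q : R * torus R d * prob R d * 'rV[R]_d | 0 <= q.1.1.1],
        continuous (fun q => H q.1.1.1 q.1.1.2 q.1.2 q.2)})
    (H_lipschitz : exists2 C : R, 0 < C &
      forall (p : 'rV[R]_d) (s t : R) (mu nu : prob R d) (x y : torus R d),
        0 <= s -> 0 <= t ->
        `|H t x mu p - H s y nu p| <=
          C * (1 + enorm p) * (`|t - s| + W2 mu nu + torus_dist x y))
    (U V : R -> prob R d -> R)
    (U_subsolution : viscosity_subsolution r H U)
    (V_supersolution : viscosity_supersolution r H V)
    (initial : forall mu : prob R d, U 0 mu <= V 0 mu) :
  forall (t : R) (mu : prob R d), 0 <= t -> U t mu <= V t mu.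
Proof.
move=> t1 mu1 t1_ge0; rewrite leNgt; apply/negP => VU.
have [C C0 HC] := H_lipschitz.
have t1_gt0 : 0 < t1 + 1 by rewrite ltr_wpDl.
(* With this value of [lam], subtracting [lam * t1] from the excess of [U] over [V] leaves exactly
   [lam]. *)
have lt0 : 0 < (U t1 mu1 - V t1 mu1) / (t1 + 1) by rewrite divr_gt0// subr_gt0.
have gap0 : 0 < U t1 mu1 - V t1 mu1 - (U t1 mu1 - V t1 mu1) / (t1 + 1) * t1.
  have E : U t1 mu1 - V t1 mu1 =
      (U t1 mu1 - V t1 mu1) / (t1 + 1) * t1 + (U t1 mu1 - V t1 mu1) / (t1 + 1).
    by field; rewrite gt_eqF.
  by rewrite {1}E addrAC subrr add0r.
move: lt0 gap0; move: (_ / (t1 + 1)) => lam lam0 gap0.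
(* Chosen so that [C * (3 / 2 * k)] is [lam / 2]. *)
have k0 : 0 < lam / (3 * C) by rewrite divr_gt0// mulr_gt0.
have K0 : 0 < 2 * (lam / (3 * C))^-1 + 5 by rewrite addr_gt0// mulr_gt0// invr_gt0.
(* Since [eps <= 1], both remaining terms of the estimate are multiples of the penalty, with total
   factor [C * (2 * k^-1 + 5)]. They stay below [lam / 4], which contradicts [lam > 0]. *)
have eta0 : 0 < lam / 4 / (C * (2 * (lam / (3 * C))^-1 + 5)).
  by rewrite !divr_gt0// mulr_gt0.
have [eps [t [s [g [/andP[eps0 eps1] tb sb gM pen]]]]] :=
  vanishing_penalty r_minimal U_subsolution.1 (lsc_usc_oppr V_supersolution)
    t1_ge0 eta0 gap0 initial.
have := maximum_estimate r_minimal H_continuous C0 HC U_subsolution V_supersolution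
  eps0 tb sb gM k0.
move: pen; set S := transport_cost g + (t - s) ^+ 2.
have S0 : 0 <= S by rewrite addr_ge0 ?sqr_ge0 ?transport_cost_ge0.
set k := lam / (3 * C) in k0 K0 eta0 *; rewrite ltr_pdivlMr ?mulr_gt0//.
have kC : C * (3 / 2 * k) = lam / 2 by rewrite /k; field; rewrite gt_eqF.
have SE : eps^-1 * S = 2 * ((2 * eps)^-1 * S) by field; rewrite gt_eqF.
have Sp : S <= 2 * ((2 * eps)^-1 * S).
  by rewrite -SE mulrC ler_peMr// invf_ge1.
rewrite SE !(mulrDr C) kC => pen.
have h : C * (k^-1 * S) <= C * (k^-1 * (2 * ((2 * eps)^-1 * S))).
  by rewrite ler_pM2l// ler_pM2l// invr_gt0.
move: pen h; move: ((2 * eps)^-1 * S) k^-1 => p k' pen h.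
by lra.
Qed.
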